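(* Let $N\ge3$, $1<p<N$, and let $A,V,K$ satisfy hypotheses $(\mathbf A)$, $(\mathbf V)$, $(\mathbf K)$ (see context). Assume that there exists $R_2>0$ such that $V(r)<+\infty$ for almost every $r>R_2$ and $$\operatorname*{ess\,sup}_{r>R_2}\frac{K(r)}{r^{\alpha_\infty}V(r)^{\beta_\infty}}<+\infty\quad\text{for some }0\le\beta_\infty\le1\text{ and }\alpha_\infty\in\mathbb R.$$ Then $\lim_{R\to+\infty}\mathcal S_\infty(q_2,R)=0$ for every $q_2\in\mathbb R$ such that $$q_2>\max\{1,\ p\beta_\infty,\ q^*(a_\infty,\alpha_\infty,\beta_\infty)\}.$$
   Context: Notation: $\mathbb R_+=(0,+\infty)$, $B_R=\{x\in\mathbb R^N:|x|<R\}$. Hypotheses: $(\mathbf A)$ $A:\mathbb R_+\to\mathbb R_+$ is continuous and there exist real numbers $a_0,a_\infty\in(p-N,p]$ and $c_0,c_\infty>0$ such that $c_0\le\liminf_{r\to0^+}A(r)/r^{a_0}\le\limsup_{r\to0^+}A(r)/r^{a_0}<+\infty$ and $c_\infty\le\liminf_{r\to+\infty}A(r)/r^{a_\infty}\le\limsup_{r\to+\infty}A(r)/r^{a_\infty}<+\infty$. $(\mathbf V)$ $V:\mathbb R_+\to[0,+\infty)$ is measurable and $V\in L^1_{\mathrm{loc}}(\mathbb R_+)$. $(\mathbf K)$ $K:\mathbb R_+\to\mathbb R_+$ is measurable and $K\in L^s_{\mathrm{loc}}(\mathbb R_+)$ for some $s>1$. Spaces: $S_A$ is the space of radial $u\in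 C_c^\infty(\mathbb R^N)$ with $\int_{\mathbb R^N}A(|x|)|\nabla u|^p\,dx<+\infty$, with norm $\|u\|_A=\left(\int_{\mathbb R^N}A(|x|)|\nabla u|^p\,dx\right)^{1/p}$. $D_A$ is the completion of $S_A$ with respect to $\|\cdot\|_A$; its elements are identified with radial functions on $\mathbb R^N\setminus\{0\}$ (weakly differentiable there, and with $\|u\|_A$ given by the same formula). $X:=D_A\cap L^p(\mathbb R^N,V(|x|)dx)$ with norm $\|u\|=\left(\|u\|_A^p+\int_{\mathbb R^N}V(|x|)|u|^p\,dx\right)^{1/p}$. For $R>0$, $q>1$: $\mathcal S_\infty(q,R):=\sup_{u\in X,\,\|u\|=1}\int_{\mathbb R^N\setminus B_R}K(|x|)|u|^q\,dx\in[0,+\infty]$. For $\alpha\in\mathbb R$, $\beta\in[0,1]$, $a>p-N$: $$q^*(a,\alpha,\beta):=p\,\frac{\alpha-p\beta+N+a\beta}{N-p+a}.$$ Convention: $V(r)^0=1$ for every $r$, even if $V(r)=0$; if $\beta_\infty>0$ and $V(r)=0$, the quotient $K(r)/(r^{\alpha_\infty}V(r)^{\beta_\infty})$ is understood as $+\infty$. *)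

(* Defs.v *)
From HB Require Import structures.
From mathcomp Require Import all_boot all_order all_algebra.
From mathcomp Require Import all_classical all_reals all_analysis.
From mathcomp Require Import ess_sup_inf.

Set Implicit Arguments.
Unset Strict Implicit.
Unset Printing Implicit Defensive.

Import Order.TTheory GRing.Theory Num.Theory.
Import numFieldNormedType.Exports.

Local Open Scope classical_set_scope.
Local Open Scope ring_scope.

(* The Borel sigma-algebra of R^n (row vectors), generated by the
   coordinates, as the library does for n.-tuple T. *)
Definition measure_rV_display : measure_display -> measure_display.
Proof. exact. Qed.

Section measurable_rV.
Context {R : realType} {n : nat}.

Let coors (i : 'I_n) (x : 'rV[R]_n) : measurableTypeR R := x ord0 i.

Let rV_set0 : g_sigma_preimage coors set0.
Proof. exact: sigma_algebra0. Qed.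

Let rV_setC A : g_sigma_preimage coors A -> g_sigma_preimage coors (~` A).
Proof. exact: sigma_algebraC. Qed.

Let rV_bigcup (F : (set 'rV[R]_n)^nat) :
  (forall i, g_sigma_preimage coors (F i)) ->
  g_sigma_preimage coors (\bigcup_i (F i)).
Proof. exact: sigma_algebra_bigcup. Qed.

HB.instance Definition _ :=
  @isMeasurable.Build (measure_rV_display default_measure_display)
    'rV[R]_n (g_sigma_preimage coors) rV_set0 rV_setC rV_bigcup.

Lemma measurable_rV_coord (i : 'I_n) :
  measurable_fun setT (fun x : 'rV[R]_n => x ord0 i : measurableTypeR R).
Proof.
move=> _ Y mY; rewrite setTI; apply: sub_sigma_algebra => /=.
rewrite -bigcup_seq/=; exists i => /=; first by rewrite mem_index_enum.
by exists Y => //; rewrite setTI.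
Qed.

Lemma measurable_fun_rV d (T : measurableType d) (f : T -> 'rV[R]_n) :
  (forall i, measurable_fun setT (fun t => f t ord0 i : measurableTypeR R)) ->
  measurable_fun setT f.
Proof.
move=> mf _ A mA; rewrite setTI.
suff: (g_sigma_preimage coors `<=` [set B | measurable (f @^-1` B)]) by exact.
apply: smallest_sub => /=.
- split => /=.
  + by rewrite preimage_set0.
  + by move=> B mB; rewrite setTD preimage_setC; exact: measurableC.
  + by move=> F mF; rewrite preimage_bigcup; exact: bigcup_measurable.
- move=> B; rewrite -bigcup_seq => -[i _ [C mC <-]] /=; rewrite setTI.
  by rewrite -[X in measurable X]setTI; exact: mf.
Qed.

End measurable_rV.

Section lebesgue_rV.
Context {R : realType}.

Definition rV_cons n (z : 'rV[R]_n * measurableTypeR R) : 'rV[R]_n.+1 :=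
  \row_(i < n.+1) if unlift ord0 i is Some j then z.1 ord0 j else z.2.

Lemma measurable_rV_cons n : measurable_fun setT (@rV_cons n).
Proof.
apply: measurable_fun_rV => i; rewrite /rV_cons.
case: (unliftP ord0 i) => [j|] ->.
- under eq_fun do rewrite mxE liftK.
  apply: (measurableT_comp (measurable_rV_coord j)).
  exact: measurable_fst.
- under eq_fun do rewrite mxE unlift_none.
  exact: measurable_snd.
Qed.

Definition borel_lebesgue_rV_step n (mu : {measure set 'rV[R]_n -> \bar R}) :
    set 'rV[R]_n.+1 -> \bar R :=
  pushforward (mu \x @lebesgue_measure R)%E (@rV_cons n).

HB.instance Definition _ n (mu : {measure set 'rV[R]_n -> \bar R}) :=
  Measure.copy (borel_lebesgue_rV_step mu)
    (measure_function_pushforward__canonical__measure_function_Measure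
       (mu \x @lebesgue_measure R)%E (@measurable_rV_cons n)).

(* N-dimensional Lebesgue measure on Borel sets, as an iterated product. *)
Fixpoint borel_lebesgue_rV (n : nat) : {measure set 'rV[R]_n -> \bar R} :=
  match n with
  | 0 => \d_(0 : 'rV[R]_0)
  | n.+1 => borel_lebesgue_rV_step (borel_lebesgue_rV n)
  end.

(* R^n with the sigma-algebra of its Lebesgue-measurable sets, and the
   (complete) Lebesgue measure on it. *)
Definition lebesgue_rV_type (n : nat) :=
  caratheodory_type ((borel_lebesgue_rV n)^*)%mu.

Definition lebesgue_rV (n : nat) : set (lebesgue_rV_type n) -> \bar R :=
  @completed_measure_extension _ _ _ (borel_lebesgue_rV n).
HB.instance Definition _ n := Measure.on (@lebesgue_rV n).

(* R with the sigma-algebra of its Lebesgue-measurable sets, i.e. the domain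
   of completed_lebesgue_measure. *)
Definition lebesgue_R_type := caratheodory_type ((@wlength R idfun)^*)%mu.

End lebesgue_rV.
Arguments lebesgue_rV_type : clear implicits.
Arguments lebesgue_rV {R} n.
Arguments lebesgue_R_type : clear implicits.

Section smooth.
Context {R : realType} {N : nat}.
Implicit Types (x y : 'rV[R]_N) (f u : 'rV[R]_N -> R).

(* The library norm on 'rV[R]_N is the sup norm. *)
Definition enorm x : R := Num.sqrt (\sum_(i < N) x ord0 i ^+ 2).

Definition partial (i : 'I_N) f : 'rV[R]_N -> R :=
  fun x => 'D_(delta_mx ord0 i) f x.

Definition grad f : 'rV[R]_N -> 'rV[R]_N := fun x => \row_i partial i f x.

Definition smooth f := forall s : seq 'I_N,
  let g := foldr partial f s in
  continuous g /\ forall i x, derivable g x (delta_mx ord0 i).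

Definition supp f : set 'rV[R]_N := closure [set x | f x != 0].

Definition radial u := forall x y, enorm x = enorm y -> u x = u y.

(* C_c^oo(R^N \ {0}) *)
Definition test_punctured f := [/\ smooth f, compact (supp f) & ~ supp f 0].

End smooth.

Section spaces.
Context {R : realType} {N : nat}.
Local Notation mu := (@lebesgue_rV R N).
Implicit Types (u : 'rV[R]_N -> R) (G : 'rV[R]_N -> 'rV[R]_N).
Implicit Types (A V K : R -> R) (p q : R).

Definition L1loc_punctured u :=
  measurable_fun (setT : set (lebesgue_rV_type R N)) u /\
  forall C : set 'rV[R]_N, compact C -> ~ C 0 ->
    (\int[mu]_(x in C) `|u x|%:E < +oo)%E.

Definition is_weak_grad u G :=
  [/\ L1loc_punctured u,
      forall i, L1loc_punctured (fun x => G x ord0 i) &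
      forall phi i, test_punctured phi ->
        (\int[mu]_x (u x * partial i phi x)%:E =
         - \int[mu]_x (G x ord0 i * phi x)%:E)%E].

Definition weakly_differentiable u := exists G, is_weak_grad u G.

(* The weak gradient of u on R^N \ {0}, unique up to a null set. *)
Definition weak_grad u : 'rV[R]_N -> 'rV[R]_N := xget (cst 0) (is_weak_grad u).

(* ||u||_A, as a function of the gradient G of u *)
Definition normA A p G : \bar R :=
  ((\int[mu]_x (A (enorm x) * enorm (G x) `^ p)%:E) `^ p^-1)%E.

Definition S_A A p u :=
  [/\ smooth u, compact (supp u), radial u & (normA A p (grad u) < +oo)%E].

(* The completion of S_A, as a function space: u is in D_A when some sequence
   of S_A tends to u almost everywhere while its gradients tend to the weak
   gradient of u in L^p(A(|x|)dx).  Such a sequence is Cauchy for ||.||_A. *)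
Definition D_A A p u :=
  [/\ radial u, weakly_differentiable u &
      exists u_ : nat -> 'rV[R]_N -> R,
        [/\ forall n, S_A A p (u_ n),
            normA A p (fun x => grad (u_ n) x - weak_grad u x)
              @[n --> \oo] --> 0%E &
            {ae mu, forall x, u_ n x @[n --> \oo] --> u x}]].

Definition intV V p u : \bar R := \int[mu]_x (V (enorm x) * `|u x| `^ p)%:E.

Definition X_space A V p u := D_A A p u /\ (intV V p u < +oo)%E.

Definition normX A V p u : \bar R :=
  ((normA A p (weak_grad u) `^ p + intV V p u) `^ p^-1)%E.

(* Supremum in [0, +oo], whence the maximum with 0. *)
Definition S_infty A V K p q r : \bar R :=
  maxe 0%E (ereal_sup
    [set (\int[mu]_(x in [set x : 'rV[R]_N | (r <= enorm x)%R])
            (K (enorm x) * `|u x| `^ q)%:E)%E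
       | u in [set u | X_space A V p u /\ normX A V p u = 1%E]]).

End spaces.

Section hypotheses.
Context {R : realType}.
Implicit Types (A V K : R -> R) (a c p s alpha beta : R).

Definition hypA (N : nat) (p : R) (A : R -> R) (a0 ainf c0 cinf : R) : Prop :=
  [/\ (forall r, 0 < r -> 0 < A r) /\ {within `]0, +oo[, continuous A},
      p - N%:R < a0 <= p /\ p - N%:R < ainf <= p,
      0 < c0 /\ 0 < cinf,
      (c0%:E <= limf_einf (fun r => (A r / r `^ a0)%:E) 0^'+)%E /\
      (limf_esup (fun r => (A r / r `^ a0)%:E) 0^'+ < +oo)%E &
      (cinf%:E <= limf_einf (fun r => (A r / r `^ ainf)%:E) +oo%R)%E /\
      (limf_esup (fun r => (A r / r `^ ainf)%:E) +oo%R < +oo)%E].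

Definition Lebesgue_measurable_Rplus (f : R -> R) :=
  measurable_fun (`]0, +oo[%classic : set (lebesgue_R_type R)) f.

Definition Lloc_Rplus s (f : R -> R) :=
  forall C : set R, C `<=` `]0, +oo[ -> compact C ->
    (\int[completed_lebesgue_measure]_(r in C) (`|f r| `^ s)%:E < +oo)%E.

Definition hypV V :=
  [/\ forall r, 0 < r -> 0 <= V r, Lebesgue_measurable_Rplus V &
      Lloc_Rplus 1 V].

Definition hypK K :=
  [/\ forall r, 0 < r -> 0 < K r, Lebesgue_measurable_Rplus K &
      exists2 s, 1 < s & Lloc_Rplus s K].

(* K / (r^alpha V^beta), equal to +oo when beta > 0 and V r = 0; powR
   satisfies 0 `^ 0 = 1. *)
Definition quotientKV K V alpha beta (r : R) : \bar R :=
  if (0 < beta) && (V r == 0) then +oo%E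
  else (K r / (r `^ alpha * V r `^ beta))%:E.

Definition ess_sup_gt (r0 : R) (f : R -> \bar R) : \bar R :=
  ess_sup (mrestr (@lebesgue_measure R) (measurable_itv `]r0, +oo[)) f.

Definition q_star (N : nat) p a alpha beta : R :=
  p * ((alpha - p * beta + N%:R + a * beta) / (N%:R - p + a)).

End hypotheses.

(* Main.v *)
From HB Require Import structures.
Require Import Defs.
From mathcomp Require Import all_boot all_order all_algebra.
From mathcomp Require Import all_classical all_reals all_analysis.
From mathcomp Require Import measurable_realfun ess_sup_inf ring lra.

Import Order.TTheory GRing.Theory Num.Theory.
Import numFieldNormedType.Exports.

Local Open Scope classical_set_scope.
Local Open Scope ring_scope.

(* Write nu = (N - p + ainf) / p, which is positive.  If u is smooth, radial and
   compactly supported, the fundamental theorem of calculus on the segments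
   parallel to the first axis that join the spheres of radii r and 2 r,
   integrated over the remaining coordinates in a cube of size ~ r, bounds the
   increment |u(2 r) - u(r)| by C r^-nu, where C depends only on a bound for
   \int A |grad u|^p; a dyadic sum gives |u(x)| <= C |x|^-nu for large |x|, and
   the bound passes to D_A by almost everywhere convergence.
   Put d = nu (q - p beta) - alpha - N (1 - beta), positive because
   q > q_star.  With K <= L |x|^alpha V^beta and X^b Y^(1-b) <= X + Y one gets,
   for |x| >= r and ||u|| = 1,
     K |u|^q <= C r^(-d/2) (V |u|^p + |x|^(-N-d/2)),
   and both terms of the right-hand factor have a uniformly bounded integral. *)

(* The library integral of a nonnegative function is the supremum of the
   integrals of the simple functions below it, even when the function is not
   measurable.  V(|x|) and K(|x|) are handled through these lemmas. *)
Section lower_integral.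
Context d (T : measurableType d) (R : realType).
Variable mu : {measure set T -> \bar R}.
Implicit Types f g : T -> \bar R.
Local Open Scope ereal_scope.
Import HBNNSimple.

(** A simple function below [f], set to zero on the exceptional null set, lies below [g] everywhere
    and keeps its integral; no measurability of [f] or [g] enters. *)
Let ge0_ae_le_lower_integral f g : (forall x, 0 <= f x) -> (forall x, 0 <= g x) ->
  {ae mu, forall x, f x <= g x} -> \int[mu]_x f x <= \int[mu]_x g x.
Proof.
move=> f0 g0 [B [mB B0 fgB]]; rewrite [leLHS]ge0_integralTE//.
apply: ge_ereal_sup => _ [h /= hf <-].
rewrite [leRHS]ge0_integralTE//.
pose h' := proj_nnsfun h (measurableC mB).
apply: ereal_sup_ubound; exists h' => /=.
  move=> x; rewrite /h' /= mindicE.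
  have [xB|xB] := boolP (x \in ~` B); rewrite ?mulr1 ?mulr0//.
  apply: (le_trans (hf x)); apply: contrapT => nfg.
  by move: xB; rewrite inE => /=; apply; exact: fgB.
rewrite -!integralT_nnsfun; apply: ge0_ae_eq_integral => //.
- by apply/measurable_EFinP.
- by apply/measurable_EFinP.
- by move=> x _; rewrite lee_fin.
- by move=> x _; rewrite lee_fin.
- exists B; split => // x /= hx; apply: contrapT => xB; apply: hx => _.
  by rewrite mindicE mem_set ?mulr1.
Qed.

Lemma ae_le_lower_integral f g :
  {ae mu, forall x, f x <= g x} -> \int[mu]_x f x <= \int[mu]_x g x.
Proof.
move=> fg; rewrite integralE [leRHS]integralE; apply: leeB.
- apply: ge0_ae_le_lower_integral => //; apply: filterS fg => x fgx.
  by rewrite !funeposE ge_max !le_max fgx lexx orbT.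
- apply: ge0_ae_le_lower_integral => //; apply: filterS fg => x fgx.
  by rewrite !funenegE ge_max !le_max leeN2 fgx lexx orbT.
Qed.

(** Lower integrals of two nonmeasurable functions need not be subadditive; one measurable summand
    suffices. For a simple [h] below [f + g], the function [k], the positive part of [h - g], is
    measurable, lies below [f], and satisfies [h <= k + g]. *)
Lemma lower_integralD_le f g : (forall x, 0 <= f x) -> (forall x, 0 <= g x) ->
  measurable_fun setT g ->
  \int[mu]_x (f x + g x) <= \int[mu]_x f x + \int[mu]_x g x.
Proof.
move=> f0 g0 mg; rewrite [leLHS]ge0_integralTE; last by move=> x; exact: adde_ge0.
apply: ge_ereal_sup => _ [h /= hf <-].
rewrite -integralT_nnsfun.
pose k x := maxe 0 ((h x)%:E - g x).
have mh : measurable_fun setT (fun x => (h x)%:E) by exact/measurable_EFinP.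
have mk : measurable_fun setT k.
  by apply: measurable_maxe => //; exact: emeasurable_funB.
apply: (@le_trans _ _ (\int[mu]_x (k x + g x))).
  apply: ge0_le_integral => //.
  - by move=> x _; rewrite lee_fin.
  - exact: emeasurable_funD.
  - move=> x _; rewrite /k; have := g0 x; case: (g x) => [r| |//] r0.
      rewrite -EFinB -EFin_max -EFinD lee_fin.
      by rewrite -lerBlDr le_max lexx orbT.
    by rewrite addey// leey.
rewrite ge0_integralD//; last by move=> x _; rewrite le_max lexx.
apply: leeD => //; apply: ae_le_lower_integral; apply: aeW => x.
rewrite /k ge_max f0 /=; have := hf x; have := g0 x; have := f0 x.
case: (g x) => [r| |//] _ _; last by rewrite addeNy leNye.
by move=> ?; rewrite leeBlDr.
Qed.

Lemma lower_integralZl_le f (k : R) : (forall x, 0 <= f x) -> (0 < k)%R ->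
  \int[mu]_x (k%:E * f x) <= k%:E * \int[mu]_x f x.
Proof.
move=> f0 k0; rewrite [leLHS]ge0_integralTE; last first.
  by move=> x; rewrite mule_ge0// lee_fin ltW.
apply: ge_ereal_sup => _ [h /= hf <-].
have k0' : (0 <= k^-1)%R by rewrite invr_ge0 ltW.
pose h' := scale_nnsfun h k0'.
have -> : sintegral mu h = k%:E * sintegral mu h'.
  by rewrite -sintegralrM; apply: eq_sintegral => x /=; rewrite mulVKf ?gt_eqF.
rewrite lee_pmul2l// -integralT_nnsfun; apply: ae_le_lower_integral; apply: aeW => x.
rewrite /h' /= EFinM; have := hf x; case: (f x) (f0 x) => [r| |//] _.
  by rewrite -!EFinM !lee_fin => hr; rewrite /cst ler_pdivrMl.
by rewrite leey.
Qed.

End lower_integral.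

(** * Borel sets and Borel functions on row vectors *)

Lemma measurable_forall d (T : sigmaRingType d) (U : countType)
    (F : U -> set T) (D : set T) : measurable D ->
  (forall i, measurable (F i)) -> measurable [set x | D x /\ forall i, F i x].
Proof.
move=> mD mF; have -> : [set x | D x /\ forall i, F i x] = D `\` \bigcup_i (D `\` F i).
  apply/seteqP; split => x /= [Dx Fx]; split => //.
    by move=> [i _ [_]]; apply; exact: Fx.
  by move=> i; apply: contrapT => nF; apply: Fx; exists i.
apply: measurableD => //; apply: countable_bigcupT_measurable => // i.
exact: measurableD.
Qed.

Section borel_rV.
Context {R : realType}.

Definition box n (c : R) : set 'rV[R]_n := [set x | forall i, `|x ord0 i| <= c].

Lemma measurable_box n (c : R) : measurable (@box n c).
Proof.
rewrite (_ : box n c = [set x | setT x /\ forall i, [set x | `|x ord0 i| <= c]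
  x]); last first.
  by apply/seteqP; split => x /=; [split|case].
apply: measurable_forall => [|i]; first exact: measurableT.
rewrite [X in measurable X](_ : _ =
    setT `&` (fun x : 'rV[R]_n => x ord0 i : measurableTypeR R) @^-1` `[- c,
      c]%classic); last first.
  by rewrite setTI; apply/seteqP; split => x /=; rewrite in_itv /= ler_norml.
exact: measurable_rV_coord.
Qed.

(** The sigma-algebra is generated by coordinates, not by open sets, so [f] is reached as a
    pointwise limit: evaluate it at the corner of the grid cell of mesh 1/(k+1) that contains the
    point. Each approximation takes countably many values, on cells cut out by coordinate
    conditions. *)
Lemma continuous_measurable_rV n (f : 'rV[R]_n -> R) :
  continuous f -> measurable_fun setT f.
Proof.
move=> cf.
pose cell k (x : 'rV[R]_n) : 'rV[int]_n := \row_i Num.floor (k.+1%:R * x ord0 i).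
pose pt k (z : 'rV[int]_n) : 'rV[R]_n := \row_i ((z ord0 i)%:~R / k.+1%:R).
apply: (@measurable_fun_cvg _ _ _ _ (fun k x => f (pt k (cell k x)))) => [k|x _].
- move=> _ Y mY; rewrite setTI.
  have -> : (fun x => f (pt k (cell k x))) @^-1` Y =
      \bigcup_(z in [set z | Y (f (pt k z))]) (cell k @^-1` [set z]).
    apply/seteqP; split => x /=; first by exists (cell k x).
    by move=> [z /= Yz zE]; rewrite zE.
  rewrite bigcup_mkcond; apply: countable_bigcupT_measurable => [|z];
    first exact: countableP.
  case: ifP => // _.
  rewrite (_ : cell k @^-1` [set z] = [set x | setT x /\
      forall i, [set x | Num.floor (k.+1%:R * x ord0 i) = z ord0 i] x]); last first.
    apply/seteqP; split => x /=; first by move=> <-; split => // i; rewrite mxE.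
    by move=> [_ xz]; apply/rowP => i; rewrite mxE.
  apply: measurable_forall => [|i]; first exact: measurableT.
  rewrite [X in measurable X](_ : _ =
    setT `&` (fun x : 'rV[R]_n => x ord0 i : measurableTypeR R) @^-1`
      `[(z ord0 i)%:~R / k.+1%:R, ((z ord0 i) + 1)%:~R / k.+1%:R[%classic); last first.
    rewrite setTI; apply/seteqP; split => x /=; rewrite in_itv /=.
      move=> <-; rewrite ler_pdivrMr// ltr_pdivlMr// mulrC.
      by rewrite floor_le /= floorD1_gt.
    rewrite ler_pdivrMr// ltr_pdivlMr// => xz; apply: floor_def.
    by rewrite mulrC.
  exact: measurable_rV_coord.
- apply: (cvg_comp (fun k => pt k (cell k x)) f _ (cf x)).
  apply/cvg_ballP => e e0; near=> k.
  split=> // i j; rewrite ord1 !mxE /=.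
  have k0 : (0 : R) < k.+1%:R by [].
  suff : `|x ord0 j - (Num.floor (k.+1%:R * x ord0 j))%:~R / k.+1%:R| < e by [].
  rewrite -(ltr_pM2l k0) -{1}(gtr0_norm k0) -normrM mulrBr mulrCA divff ?gt_eqF// mulr1.
  rewrite ger0_norm; last by rewrite subr_ge0 floor_le.
  apply: (@lt_le_trans _ _ 1).
    by rewrite ltrBlDr addrC -[X in _ < _ + X]/(1%:~R) -intrD floorD1_gt.
  rewrite -ler_pdivrMr// mul1r.
  rewrite (@le_trans _ _ k%:R) ?ler_nat//.
  near: k; exact: nbhs_infty_ger.
Unshelve. all: by end_near. Qed.

End borel_rV.

(** * The Euclidean norm: coordinates, slices and cubes *)

Section enorm.
Context {R : realType}.

Lemma enorm_ge0 {n} (x : 'rV[R]_n) : 0 <= enorm x.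
Proof. exact: sqrtr_ge0. Qed.

Lemma sqr_enorm {n} (x : 'rV[R]_n) : enorm x ^+ 2 = \sum_(i < n) x ord0 i ^+ 2.
Proof. by rewrite sqr_sqrtr// sumr_ge0// => i _; rewrite sqr_ge0. Qed.

Lemma coord_le_enorm {n} (x : 'rV[R]_n) i : `|x ord0 i| <= enorm x.
Proof.
rewrite -sqrtr_sqr ler_wsqrtr// (bigD1 i)//= lerDl sumr_ge0// => j _.
exact: sqr_ge0.
Qed.

Lemma measurable_enorm n : measurable_fun setT (@enorm R n).
Proof.
apply: (measurableT_comp (f := @Num.sqrt R)).
  by apply: continuous_measurable_fun; exact: sqrt_continuous.
apply: measurable_sum => i; apply: measurable_funX.
exact: measurable_rV_coord.
Qed.

Lemma enorm_eq0 {n} (x : 'rV[R]_n) : enorm x = 0 -> x = 0.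
Proof.
move=> x0; apply/rowP => i; rewrite mxE; apply/eqP.
by rewrite -normr_le0 -x0 coord_le_enorm.
Qed.

Lemma rV_cons0 {n} (z : 'rV[R]_n * measurableTypeR R) : rV_cons z ord0 ord0 = z.2.
Proof. by rewrite mxE unlift_none. Qed.

Lemma rV_consS {n} (z : 'rV[R]_n * measurableTypeR R) i :
  rV_cons z ord0 (lift ord0 i) = z.1 ord0 i.
Proof. by rewrite mxE liftK. Qed.

Lemma enorm_rV_cons {n} (z : 'rV[R]_n * measurableTypeR R) :
  enorm (rV_cons z) = Num.sqrt (z.2 ^+ 2 + enorm z.1 ^+ 2).
Proof.
rewrite sqr_enorm {1}/enorm big_ord_recl rV_cons0; congr (Num.sqrt (_ + _)).
by apply: eq_bigr => i _; rewrite rV_consS.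
Qed.

Lemma enorm_box {n} (x : 'rV[R]_n) (c : R) : box n c x ->
  enorm x ^+ 2 <= n%:R * c ^+ 2.
Proof.
move=> xc; rewrite sqr_enorm mulr_natl -[X in _ <= _ *+ X]card_ord -sumr_const.
apply: ler_sum => i _; rewrite -(@real_normK _ (x ord0 i)) ?num_real//.
by rewrite lerXn2r ?nnegrE// (le_trans _ (xc i)).
Qed.

End enorm.

(** * Lebesgue measure: volume of cubes, slicing along the first axis, Borel versus completed
    measure *)

Section lebesgue_rV_measure.
Context {R : realType}.
Local Notation mu := (@lebesgue_measure R).

(* A plain set function, so that a sigma-finite instance can be attached to it. *)
Definition borel_rV n : set 'rV[R]_n -> \bar R := borel_lebesgue_rV n.

HB.instance Definition _ n := Measure.copy (@borel_rV n) (borel_lebesgue_rV n).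

Lemma borel_rV_box n (c : R) : 0 <= c -> borel_rV n (box n c) = ((2 * c) ^+ n)%:E.
Proof.
move=> c0; elim: n => [|n IHn].
  by rewrite /borel_rV /= diracE mem_set// => -[].
rewrite /borel_rV /= /borel_lebesgue_rV_step /pushforward.
rewrite (_ : _ @^-1` _ = box n c `*` `[- c, c]%classic); last first.
  apply/seteqP; split => -[y t] /=.
    move=> yt; split; last by rewrite in_itv /= -ler_norml -[t](rV_cons0 (y, t)).
    by move=> i; rewrite -[y](_ : (y, t).1 = y)// -rV_consS.
  move=> [yc]; rewrite in_itv /= -ler_norml => tc i.
  by case: (unliftP ord0 i) => [j ->|->]; rewrite ?rV_consS ?rV_cons0//=.
rewrite product_measure1E//; last exact: measurable_box.
have mucc : mu `[- c, c]%classic = (2 * c)%:E.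
  rewrite lebesgue_measure_itv /= lte_fin; case: ltP => cc.
    by rewrite -EFinB opprK mulr_natl.
  by congr EFin; lra.
by rewrite [X in (_ * X)%E]mucc [X in (X * _)%E]IHn -EFinM exprSr.
Qed.

Lemma borel_rV_sigma_finite n : sigma_finite setT (@borel_rV n).
Proof.
exists (fun k => box n k%:R) => [|k].
  apply/seteqP; split => // x _; exists (Num.bound (enorm x)) => // i.
  rewrite (le_trans (coord_le_enorm _ _))// ltW//.
  exact: archi_boundP (enorm_ge0 _).
by split; [exact: measurable_box|rewrite borel_rV_box// ltry].
Qed.

HB.instance Definition _ n := Measure_isSigmaFinite.Build _ _ _ (@borel_rV n)
  (@borel_rV_sigma_finite n).

Lemma integral_borel_rVS n (f : 'rV[R]_n.+1 -> \bar R) :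
  measurable_fun setT f -> (forall x, 0 <= f x)%E ->
  (\int[borel_rV n.+1]_x f x =
   \int[borel_rV n]_y \int[mu]_t f (rV_cons (y, t)))%E.
Proof.
move=> mf f0.
rewrite (ge0_integral_pushforward (@measurable_rV_cons R n))//.
rewrite preimage_setT (fubini_tonelli1 (m1 := borel_rV n))//.
  by apply: measurableT_comp => //; exact: measurable_rV_cons.
by move=> x; exact: f0.
Qed.

Lemma lebesgue_rVE n (A : set 'rV[R]_n) : measurable A ->
  lebesgue_rV n A = borel_rV n A.
Proof. by move=> mA; exact: measurable_mu_extE. Qed.

Lemma measurable_lebesgue_rV n (A : set 'rV[R]_n) : measurable A ->
  measurable (A : set (lebesgue_rV_type R n)).
Proof. exact: caratheodory_measurable_mu_ext. Qed.

Lemma measurable_fun_lebesgue_rV d (T : measurableType d) n (f : 'rV[R]_n -> T) :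
  measurable_fun setT f -> measurable_fun (setT : set (lebesgue_rV_type R n)) f.
Proof.
move=> mf _ Y mY; rewrite setTI; apply: measurable_lebesgue_rV.
by rewrite -[X in measurable X]setTI; exact: mf.
Qed.

(** The identity from the completed space to the Borel space is measurable and pushes the completed
    measure to the Borel one. Iterated integrals are thus available for Borel integrands. *)
Lemma integral_lebesgue_rV n (f : 'rV[R]_n -> \bar R) :
  measurable_fun setT f -> (forall x, 0 <= f x)%E ->
  (\int[lebesgue_rV n]_x f x = \int[borel_rV n]_x f x)%E.
Proof.
move=> mf f0.
have mid : measurable_fun (setT : set (lebesgue_rV_type R n)) (id : _ -> 'rV[R]_n).
  by apply: measurable_fun_lebesgue_rV; exact: measurable_id.
rewrite -[LHS](ge0_integral_pushforward mid (lebesgue_rV n) (f := f) (D := setT))//.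
by apply: eq_measure_integral => A mA _; exact: lebesgue_rVE.
Qed.

End lebesgue_rV_measure.

(** * A null set of radii is the radius of a null set of points *)

Section null_preimage.
Context {R : realType}.
Local Notation mu := (@lebesgue_measure R).

(** Since [f] expands distances on [D] by at least [k], the part of [D] sent into an interval of
    length l has diameter at most l / k, so it lies in an interval of length 2 l / k. A cover of [Z]
    of total length below k e / 2 thus yields a cover of the preimage of total length at most e. *)
Lemma null_expanding_preimage (f : R -> R) (D Z : set R) (k : R) : 0 < k ->
  (forall s t, D s -> D t -> k * `|s - t| <= `|f s - f t|) ->
  mu Z = 0%E -> measurable (D `&` f @^-1` Z) -> mu (D `&` f @^-1` Z) = 0%E.
Proof.
move=> k0 kf Z0 mDZ; apply/eqP; rewrite eq_le measure_ge0 andbT.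
apply/lee_addgt0Pr => e e0; rewrite add0e.
have ke0 : 0 < k * e / 2 by rewrite divr_gt0 ?mulr_gt0.
have : (mu Z < (k * e / 2)%:E)%E by rewrite Z0 lte_fin.
move=> /ereal_inf_lt[_ [F [mF ZF] <-] Fe].
have mF' i : exists ab : R * R, ab.1 <= ab.2 /\ F i = `]ab.1, ab.2]%classic.
  have [[a b] _ <-] := mF i; case: (leP a b) => ab; first by exists (a, b).
  by exists (a, a); rewrite /= set_itvxx !set_itv_ge// bnd_simp -leNgt ltW.
move: mF' => /choice[ab /all_and2[leab FE]].
(* Any point of the preimage serves as a centre. The default 0 occurs only for an empty preimage,
   where nothing has to be covered. *)
pose c i := xget 0 (D `&` f @^-1` F i).
pose l i := ((ab i).2 - (ab i).1) / k.
pose B i : set R := `[c i - l i, c i + l i]%classic.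
have DB : D `&` f @^-1` Z `<=` \bigcup_i B i.
  move=> t [Dt /ZF[i _ Fit]]; exists i => //.
  have [Dc Fc] : (D `&` f @^-1` F i) (c i) by apply: xgetPex; exists t.
  rewrite /B /= in_itv /= -ler_distlC /l ler_pdivlMr// mulrC.
  apply: (le_trans (kf _ _ Dc Dt)).
  move: Fc Fit; rewrite /= FE /= !in_itv /= => /andP[? ?] /andP[? ?].
  by rewrite ler_norml; apply/andP; split; lra.
have mB i : measurable (B i) by exact: measurable_itv.
apply: (@le_trans _ _ (\sum_(i <oo) mu (B i))%E).
  exact: (@measure_sigma_subadditive _ _ _ mu (D `&` f @^-1` Z) B mB mDZ DB).
have muB i : mu (B i) = ((2 / k)%:E * wlength idfun (F i))%E.
  rewrite FE wlength_itv_bnd// -EFinM lebesgue_measure_itv /= lte_fin.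
  have l0 : 0 <= l i by rewrite divr_ge0 ?subr_ge0// ltW.
  case: ltP => ?; first by rewrite -EFinB; congr EFin; rewrite /l; field;
    exact: lt0r_neq0.
  have : l i = 0 by lra.
  by rewrite /l => l00; congr EFin; rewrite -[2 / k]mulrC -mulrA (mulrC 2)
    mulrA (mulrC k^-1) l00 mul0r.
under eq_eseriesr do rewrite muB.
have F0 i : (0 <= wlength idfun (F i))%E.
  by rewrite FE wlength_itv_bnd// lee_fin subr_ge0; exact: leab.
rewrite nneseriesZl//.
have k20 : 0 < 2 / k by rewrite divr_gt0.
apply: (@le_trans _ _ ((2 / k)%:E * (k * e / 2)%:E)%E).
  by rewrite lee_pmul2l// ltW.
rewrite -EFinM lee_fin le_eqVlt; apply/orP; left; apply/eqP.
by field; exact: lt0r_neq0.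
Qed.

(** The map t |-> sqrt (t ^ 2 + c) is the radius along a line parallel to the first axis, with c the
    squared norm of the other coordinates. Its slope may vanish at 0, so the line is cut into
    countably many compact pieces avoiding 0, plus the null set {0}. *)
Lemma null_sqrtD_preimage (c : R) (Z : set R) : 0 <= c -> measurable Z ->
  mu Z = 0%E -> mu [set t | Z (Num.sqrt (t ^+ 2 + c))] = 0%E.
Proof.
move=> c0 mZ Z0; pose f (t : R) := Num.sqrt (t ^+ 2 + c).
have mf : measurable_fun setT f.
  apply: (measurableT_comp (f := @Num.sqrt R)).
    by apply: continuous_measurable_fun; exact: sqrt_continuous.
  apply: measurable_funD => //; apply: measurable_funX; exact: measurable_id.
have mfZ : measurable (f @^-1` Z) by rewrite -[X in measurable X]setTI; exact: mf.
pose D (b : bool) (n : nat) : set R :=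
  if b then `[n.+1%:R^-1, n%:R]%classic else `[- n%:R, - n.+1%:R^-1]%classic.
have mD b n : measurable (D b n) by rewrite /D; case: b; exact: measurable_itv.
(* Away from 0 and infinity, t |-> sqrt (t ^ 2 + c) expands distances. *)
have DZ0 b n : mu (D b n `&` f @^-1` Z) = 0%E.
  pose F := Num.sqrt (n%:R ^+ 2 + c) + 1.
  have F0 : 0 < F by rewrite ltr_wpDl ?sqrtr_ge0.
  have a0 : (0 : R) < n.+1%:R^-1 by rewrite invr_gt0.
  apply: (@null_expanding_preimage _ _ _ (n.+1%:R^-1 / F)) => //.
  - by rewrite divr_gt0.
  - move=> s t Ds Dt.
    have fF r : D b n r -> 0 <= f r <= F.
      move=> Dr; rewrite sqrtr_ge0/= /F (@le_trans _ _ (Num.sqrt (n%:R ^+ 2 +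
        c)))//; last lra.
      rewrite ler_wsqrtr// lerD2r -real_normK ?num_real// lerXn2r ?nnegrE//.
      have n0 : (0 : R) <= n%:R by [].
      by move: a0 n0 Dr; rewrite /D ler_norml;
        move: (n.+1%:R^-1) (n%:R) => a m a0 m0; case: (b);
        rewrite /= in_itv /= => /andP[? ?]; apply/andP; split; lra.
    have st2 : 2 * n.+1%:R^-1 <= `|s + t|.
      move: a0 Ds Dt; rewrite /D; move: (n.+1%:R^-1) => a a0;
        rewrite ler_normr; case: (b); rewrite /= !in_itv /= =>
        /andP[? ?] /andP[? ?]; apply/orP; [left|right]; lra.
    rewrite mulrAC ler_pdivrMr//.
    (* Both sides are |s ^ 2 - t ^ 2|. The lower bound on |s + t| and the upper bound on f s + f t
       then give the expansion constant. *)
    have E : `|s - t| * `|s + t| = `|f s - f t| * `|f s + f t|.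
      rewrite -!normrM -!subr_sqr !sqr_sqrtr ?addr_ge0 ?sqr_ge0//.
      by congr `|_|; lra.
    have H1 : `|s - t| * (2 * n.+1%:R^-1) <= `|s - t| * `|s + t| by exact: ler_wpM2l.
    have H2 : `|f s - f t| * `|f s + f t| <= `|f s - f t| * (2 * F).
      have /andP[? ?] := fF s Ds; have /andP[? ?] := fF t Dt.
      by apply: ler_wpM2l => //; rewrite ger0_norm ?addr_ge0//; lra.
    move: E H1 H2; move: (n.+1%:R^-1) `|s - t| `|f s - f t| `|s + t| `|f s + f
      t| => a u v w z E H1 H2.
    by rewrite E in H1; lra.
  - exact: measurableI.
have -> : [set t | Z (Num.sqrt (t ^+ 2 + c))] = f @^-1` Z by [].
have mDZ b n : measurable (D b n `&` f @^-1` Z) by exact: measurableI.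
have cover : f @^-1` Z `<=` [set 0] `|` (\bigcup_n (D true n `&` f @^-1` Z) `|`
    \bigcup_n (D false n `&` f @^-1` Z)).
  move=> t Zt; have [->|t0] := eqVneq t 0; [by left|right].
  pose n := maxn (Num.bound `|t|) (Num.bound `|t|^-1).
  have nt : `|t| <= n%:R.
    by rewrite (le_trans (ltW (archi_boundP (normr_ge0 t))))// ler_nat leq_maxl.
  have nt1 : n.+1%:R^-1 <= `|t|.
    rewrite invf_ple ?posrE ?normr_gt0//.
    have t1 : 0 <= `|t|^-1 by rewrite invr_ge0.
    by rewrite (le_trans (ltW (archi_boundP t1)))// ler_nat (leq_trans
      (leq_maxr _ _) (leqnSn n)).
  move: nt nt1; case: (leP 0 t) => t1; [rewrite ger0_norm//|rewrite
    ltr0_norm//] => nt nt1.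
    by left; exists n => //; split => //; rewrite /D /= in_itv /= nt nt1.
  by right; exists n => //; split => //; rewrite /D /= in_itv /= lerNl nt lerNr nt1.
have mb b : measurable (\bigcup_n (D b n `&` f @^-1` Z)).
  by apply: bigcupT_measurable; exact: mDZ.
have bz b : mu (\bigcup_n (D b n `&` f @^-1` Z)) = 0%E.
  apply/eqP; rewrite eq_le measure_ge0 andbT.
  apply: (@le_trans _ _ (\sum_(n <oo) mu (D b n `&` f @^-1` Z))%E).
    exact: (@measure_sigma_subadditive _ _ _ mu _ _ (mDZ b) (mb b)).
  by rewrite eseries0// => i _ _; exact: DZ0.
have mbb := measurableU _ _ (mb true) (mb false).
apply: (@subset_measure0 _ _ _ mu _ _ mfZ _ cover).
  exact: (measurableU _ _ _ mbb).
apply: null_set_setU => //; first exact: lebesgue_measure_set1.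
apply: null_set_setU; [exact: mb|exact: mb|exact: bz|exact: bz].
Qed.

(** By Tonelli it is enough that every slice along the first axis is null. This transfers almost
    everywhere statements about r to statements about |x|. *)
Lemma null_enorm_preimage n (Z : set R) : measurable Z -> mu Z = 0%E ->
  borel_rV n.+1 (@enorm R n.+1 @^-1` Z) = 0%E.
Proof.
move=> mZ Z0.
have mE : measurable (@enorm R n.+1 @^-1` Z).
  by rewrite -[X in measurable X]setTI; exact: measurable_enorm.
have mI : measurable_fun setT (fun x => (\1_(@enorm R n.+1 @^-1` Z) x)%:E : \bar R).
  by apply/measurable_EFinP; exact: measurable_indic.
rewrite -[_ @^-1` _]setIT -[LHS]integral_indic// integral_borel_rVS//.
rewrite integral0_eq// => y _.
transitivity (\int[mu]_t (\1_[set t | Z (Num.sqrt (t ^+ 2 + enorm y ^+ 2))] t)%:E)%E.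
  apply: eq_integral => t _; rewrite !indicE; congr ((nat_of_bool _)%:R%:E).
  by apply/idP/idP; rewrite !inE /= enorm_rV_cons.
rewrite integral_indic//; first by rewrite setIT;
  apply: null_sqrtD_preimage => //; exact: sqr_ge0.
rewrite (_ : [set t | _] = (fun t : R => rV_cons (y, t) : 'rV[R]_n.+1) @^-1`
  (@enorm R n.+1 @^-1` Z)); last first.
  by apply/seteqP; split => t /=; rewrite enorm_rV_cons.
rewrite -[X in measurable X]setTI.
have mc : measurable_fun setT (fun t : R => rV_cons (y, t) : 'rV[R]_n.+1).
  by apply: measurableT_comp; [exact: measurable_rV_cons|exact: measurable_pair1].
exact: mc.
Qed.

End null_preimage.

(** * Fundamental theorem of calculus on lines parallel to the first axis *)

Section vertical_lines.
Context {R : realType} {n : nat}.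
Implicit Types u : 'rV[R]_n.+1 -> R.
Local Notation mu := (@lebesgue_measure R).

Lemma rV_cons_shift (y : 'rV[R]_n) (t h : R) :
  rV_cons (y, h + t) = h *: delta_mx ord0 ord0 + rV_cons (y, t) :> 'rV[R]_n.+1.
Proof.
apply/rowP => i; case: (unliftP ord0 i) => [j|] ->; rewrite [RHS]mxE.
  by rewrite !rV_consS !mxE /= ?andbF mulr0 add0r.
by rewrite !rV_cons0 !mxE !eqxx mulr1.
Qed.

Lemma continuous_rV_cons (y : 'rV[R]_n) :
  continuous (fun t : R => rV_cons (y, t) : 'rV[R]_n.+1).
Proof.
move=> t; apply/cvg_ballP => e e0; near=> s; split => // i j; rewrite ord1.
case: (unliftP ord0 j) => [k|] ->.
  by rewrite !rV_consS; exact: ballxx.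
rewrite !rV_cons0 /=; near: s; exact: (nbhsx_ballx t e e0).
Unshelve. all: by end_near. Qed.

Lemma smooth_continuous_partial u i : smooth u -> continuous (partial i u).
Proof. by move=> /(_ [:: i])[]. Qed.

Lemma smooth_continuous u : smooth u -> continuous u.
Proof. by move=> /(_ [::])[]. Qed.

Lemma vertical_difference_le u (y : 'rV[R]_n) (a b : R) : smooth u -> a < b ->
  (`|u (rV_cons (y, b)) - u (rV_cons (y, a))|%:E <=
   \int[mu]_(t in `[a, b]) `|partial ord0 u (rV_cons (y, t))|%:E)%E.
Proof.
move=> su ab; pose g (t : R) := u (rV_cons (y, t)).
have cg : continuous g.
  by move=> t; apply: continuous_comp; [exact: continuous_rV_cons|exact:
    smooth_continuous].
pose g' (t : R) := partial ord0 u (rV_cons (y, t)).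
have cg' : continuous g'.
  move=> t; apply: continuous_comp; first exact: continuous_rV_cons.
  exact: smooth_continuous_partial.
(* The difference quotient of the slice is that of [u] in the first direction, so derivability and
   the value of the derivative carry over. *)
have quotE t : (fun h : R => h^-1 *: ((g \o shift t) (h *: 1) - g t)) =
    (fun h => h^-1 *: ((u \o shift (rV_cons (y, t))) (h *: delta_mx ord0 ord0)
      - u (rV_cons (y, t)))).
  apply/funext => h /=; rewrite /g /= -rV_cons_shift.
  by rewrite [h *: (1 : R)]mulr1.
have dg t : derivable g t 1.
  rewrite /derivable quotE; have [_ /(_ ord0 (rV_cons (y, t)))] := su [::]; exact.
have g'E t : 'D_1 g t = g' t by rewrite /derive quotE.
have := @continuous_FTC2 _ g' g a b ab _ _ _.
move=> /(_ (continuous_subspaceT cg')) => FTC.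
have {}FTC : (\int[mu]_(x in `[a, b]) (g' x)%:E = (g b)%:E - (g a)%:E)%E.
  apply: FTC.
  - split => [t _||]; first exact: dg.
    + exact/cvg_at_right_filter/cg.
    + exact/cvg_at_left_filter/cg.
  - by move=> t _; rewrite derive1E g'E.
rewrite -[leLHS]/(`|(g b)%:E - (g a)%:E|)%E -FTC.
apply: le_abse_integral => //; apply/measurable_EFinP.
by apply: measurable_funTS; exact: continuous_measurable_fun.
Qed.

End vertical_lines.

(** * Increment of a radial function between the spheres of radii r and 2 r *)

Section dyadic.
Context {R : realType} {n : nat}.
Implicit Types u : 'rV[R]_n.+1 -> R.
Local Notation mu := (@lebesgue_measure R).

(** A cube minus a Euclidean ball, large enough to contain every segment used below. On it |x| is
    comparable to r, and its volume is at most that of the cube, (4 r) ^ N. *)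
Definition dyadic_shell (r : R) : set 'rV[R]_n.+1 :=
  box n.+1 (2 * r) `&` [set x | r / 2 <= enorm x].

Lemma measurable_dyadic_shell r : measurable (dyadic_shell r).
Proof.
apply: measurableI; first exact: measurable_box.
rewrite (_ : [set x | _] = @enorm R n.+1 @^-1` `[r / 2, +oo[%classic).
  by rewrite -[X in measurable X]setTI; exact: measurable_enorm.
by apply/seteqP; split => x /=; rewrite in_itv /= andbT.
Qed.

Lemma measurable_partial_shell u r : smooth u ->
  measurable_fun setT (fun z => (`|partial ord0 u z| * \1_(dyadic_shell r)
    z)%:E : \bar R).
Proof.
move=> su; apply/measurable_EFinP; apply: measurable_funM.
  apply: measurableT_comp => //; apply: continuous_measurable_rV.
  exact: smooth_continuous_partial.
by apply: measurable_indic; exact: measurable_dyadic_shell.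
Qed.

(** For [y] in a small cube, the line over [y] meets the two spheres at heights [t1] and [t2]. As
    [u] is radial, its increment between them does not depend on [y]; integrating over the cube, of
    volume (r / N) ^ n, gives the bound. *)
Lemma dyadic_increment_le u (r : R) (x x' : 'rV[R]_n.+1) : smooth u -> radial u ->
  0 < r -> enorm x = r -> enorm x' = 2 * r ->
  ((`|u x' - u x| * (r / n.+1%:R) ^+ n)%:E <=
   \int[borel_rV n.+1]_z (`|partial ord0 u z| * \1_(dyadic_shell r) z)%:E)%E.
Proof.
move=> su ru r0 xr x'r.
pose F z : \bar R := (`|partial ord0 u z| * \1_(dyadic_shell r) z)%:E.
have F0 z : (0 <= F z)%E by rewrite lee_fin mulr_ge0.
rewrite integral_borel_rVS//; last exact: measurable_partial_shell.
(* This half-side forces |y| <= r / 2, hence [t1 >= r / 2], which keeps the segment inside the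
   shell. *)
pose c : R := r / n.+1%:R / 2.
have n0 : (0 : R) < n.+1%:R by [].
have c0 : 0 < c by rewrite !divr_gt0.
have cE : 2 * c = r / n.+1%:R by rewrite /c mulrC divfK.
set D := `|u x' - u x|.
have lineD y : box n c y -> (D%:E <= \int[mu]_t F (rV_cons (y, t)))%E.
  move=> yc; have ybnd : enorm y ^+ 2 <= r ^+ 2 / 4.
    rewrite (le_trans (enorm_box _ _ yc))//.
    have -> : r ^+ 2 / 4 = n.+1%:R ^+ 2 * c ^+ 2.
      by rewrite /c; field; rewrite gt_eqF.
    rewrite ler_wpM2r ?sqr_ge0// -natrX ler_nat.
    by rewrite (leq_trans (leqnSn n))// -[leqLHS]muln1 expnS leq_mul.
  set e := enorm y ^+ 2 in ybnd.
  have e0 : 0 <= e by exact: sqr_ge0.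
  have r2 : 0 < r ^+ 2 by rewrite exprn_gt0.
  pose t1 := Num.sqrt (r ^+ 2 - e); pose t2 := Num.sqrt ((2 * r) ^+ 2 - e).
  have E4 : (2 * r) ^+ 2 = 4 * r ^+ 2 by ring.
  have t12 : t1 < t2 by rewrite ltr_sqrt; lra.
  have rt1 : r / 2 <= t1.
    have r20 : 0 <= r / 2 by lra.
    rewrite -(ger0_norm r20) -sqrtr_sqr /t1 ler_wsqrtr//.
    by rewrite expr_div_n (_ : 2 ^+ 2 = 4 :> R); [lra|ring].
  have t2r : t2 <= 2 * r.
    have r20 : 0 <= 2 * r by lra.
    rewrite -(ger0_norm r20).
    by rewrite -sqrtr_sqr /t2 ler_wsqrtr//; lra.
  have e1 : enorm (rV_cons (y, t1) : 'rV[R]_n.+1) = r.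
    rewrite enorm_rV_cons /= sqr_sqrtr; last lra.
    by rewrite subrK sqrtr_sqr gtr0_norm.
  have e2 : enorm (rV_cons (y, t2) : 'rV[R]_n.+1) = 2 * r.
    rewrite enorm_rV_cons /= sqr_sqrtr; last lra.
    by rewrite subrK sqrtr_sqr gtr0_norm// mulr_gt0.
  have -> : D = `|u (rV_cons (y, t2)) - u (rV_cons (y, t1))|.
    by rewrite /D; congr `|_ - _|; apply: ru; rewrite ?e1 ?e2.
  apply: (le_trans (vertical_difference_le _ _ _ _ su t12)).
  rewrite integral_mkcond; apply: ae_le_lower_integral; apply: aeW => t.
  rewrite /patch; case: ifPn => [|_]; last exact: F0.
  rewrite inE /= in_itv /= => /andP[tt1 tt2].
  rewrite lee_fin indicE mem_set ?mulr1//; split => /=.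
    move=> i; case: (unliftP ord0 i) => [j|] ->; rewrite ?rV_consS ?rV_cons0 /=.
      rewrite (le_trans (yc j))//.
      have : c <= r / 2.
        by rewrite /c ler_pM2r// ler_pdivrMr// ler_peMr ?ler1n// ltW.
      by lra.
    by rewrite ler_norml; apply/andP; split; lra.
  rewrite (le_trans rt1)// (le_trans tt1)//.
  have := coord_le_enorm (rV_cons (y, t)) ord0; rewrite rV_cons0 /=.
  by apply: le_trans; exact: ler_norm.
apply: (@le_trans _ _ (\int[borel_rV n]_y (D%:E * (\1_(box n c) y)%:E))%E).
  rewrite ge0_integralZl_EFin//; last 2 first.
  - by apply/measurable_EFinP; apply: measurable_indic; exact: measurable_box.
  - exact: normr_ge0.
  rewrite integral_indic//; last exact: measurable_box.
  by rewrite setIT [X in (_ * X)%E](borel_rV_box n c (ltW c0)) cE -EFinM.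
apply: ae_le_lower_integral; apply: aeW => y; rewrite indicE.
case: (boolP (y \in box n c)) => [|_]; last first.
  by rewrite mule0; apply: integral_ge0 => t _; exact: F0.
by rewrite inE mule1 => /lineD.
Qed.

End dyadic.

(** * The increment is of order r^-nu when the energy is bounded *)

Lemma le0_ger_powR (R : realType) (a x y : R) : a <= 0 -> 0 < x -> x <= y ->
  y `^ a <= x `^ a.
Proof.
move=> a0 x0 xy; rewrite -[a]opprK powRN [leRHS]powRN.
have y0 : 0 < y := lt_le_trans x0 xy.
rewrite lef_pV2 ?posrE ?powR_gt0//.
by rewrite ge0_ler_powR ?nnegrE ?oppr_ge0// ltW.
Qed.

Lemma gt0_powRD (R : realType) (x a b : R) : 0 < x ->
  x `^ (a + b) = x `^ a * x `^ b.
Proof. by move=> x0; rewrite powRD// (gt_eqF x0) implybT. Qed.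

Section radial_decay.
Context {R : realType} {n : nat}.
Local Notation N := n.+1.
Local Notation mu := (@lebesgue_rV R N).
Implicit Types (u : 'rV[R]_N -> R) (A : R -> R).

(* ||.||_A ^ p, as a function of the gradient. *)
Definition energy A p (G : 'rV[R]_N -> 'rV[R]_N) : \bar R :=
  (\int[mu]_x (A (enorm x) * enorm (G x) `^ p)%:E)%E.

Lemma ae_lebesgue_rV_filter k : Filter (almost_everywhere (@lebesgue_rV R k)).
Proof. exact: (@ae_filter_ringOfSetsType _ _ _ (@lebesgue_rV R k)). Qed.

#[local] Hint Extern 0 (Filter (nbhs (almost_everywhere _))) =>
  (apply: ae_lebesgue_rV_filter) : typeclass_instances.

Lemma ae_neq0 : {ae mu, forall x, x != 0}.
Proof.
exists (box N 0); split.
- by apply: measurable_lebesgue_rV; exact: measurable_box.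
- rewrite /= lebesgue_rVE; last exact: measurable_box.
  by rewrite borel_rV_box// mulr0 expr0n.
- by move=> x /= /negP; rewrite negbK => /eqP -> i; rewrite mxE normr0.
Qed.

Lemma enorm_gt0 (x : 'rV[R]_N) : x != 0 -> 0 < enorm x.
Proof.
move=> x0; rewrite lt_neqAle enorm_ge0 andbT eq_sym; apply/eqP.
by move/enorm_eq0 => xE; rewrite xE eqxx in x0.
Qed.

Lemma enormZ (c : R) (x : 'rV[R]_N) : enorm (c *: x) = `|c| * enorm x.
Proof.
rewrite /enorm -sqrtr_sqr -sqrtrM ?sqr_ge0// mulr_sumr.
by congr Num.sqrt; apply: eq_bigr => i _; rewrite mxE exprMn.
Qed.

Lemma energy_pos_le A p G : (forall r, 0 < r -> 0 < A r) ->
  (\int[mu]_x (Num.max 0 (A (enorm x) * enorm (G x) `^ p))%:E <= energy A p G)%E.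
Proof.
move=> A0; apply: ae_le_lower_integral; apply: filterS ae_neq0 => x x0.
rewrite lee_fin ge_max lexx andbT mulr_ge0 ?powR_ge0// ltW// A0//.
by apply: enorm_gt0.
Qed.

(** A pointwise substitute for Hoelder's inequality with a free threshold [d]: either g <= d, or e >
    d and e = e^(1-p) e^p <= d^(1-p) e^p because 1 - p < 0. *)
Lemma le_add_powR (p d g e : R) : 1 < p -> 0 < d -> g <= e ->
  g <= d + d `^ (1 - p) * e `^ p.
Proof.
move=> p1 d0 ge; have [gd|dg] := leP g d.
  by rewrite (le_trans gd)// lerDl mulr_ge0// powR_ge0.
have de : d < e := lt_le_trans dg ge.
have e0 : 0 < e := lt_trans d0 de.
rewrite (le_trans ge)// -[leLHS]add0r lerD//; first exact: ltW.
have {1}-> : e = e `^ (1 - p) * e `^ p.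
  by rewrite -gt0_powRD// subrK powRr1// ltW.
rewrite ler_wpM2r ?powR_ge0// le0_ger_powR//; last exact: ltW.
by rewrite subr_le0 ltW.
Qed.

Lemma partial_le_enorm_grad u i (x : 'rV[R]_N) : `|partial i u x| <= enorm (grad u x).
Proof. by have := coord_le_enorm (grad u x) i; rewrite mxE. Qed.

(** On the shell the weight is at least m r^a, so [le_add_powR] bounds the first derivative by a
    constant [d] plus a multiple of the energy density. The volume of the cube controls the first
    term and [M] the second. *)
Lemma dyadic_decay A (p a m R1 M : R) : 1 < p -> 0 < m -> 0 < R1 -> 0 <= M ->
  (forall r, 0 < r -> 0 < A r) ->
  (forall r x, R1 <= r -> @dyadic_shell R n r x -> m * r `^ a <= A (enorm x)) ->
  exists2 C, 0 <= C & forall u, smooth u -> radial u ->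
  (energy A p (grad u) <= M%:E)%E ->
  forall x x', R1 <= enorm x -> enorm x' = 2 * enorm x ->
  `|u x' - u x| <= C * enorm x `^ (- ((N%:R - p + a) / p)).
Proof.
move=> p1 m0 R10 M0 A0 mA.
set nu := _ / p.
exists (n.+1%:R ^+ n * (M / m + 4 ^+ N)).
  by rewrite mulr_ge0// addr_ge0// divr_ge0// ltW.
move=> u su ru uM x x' Rx x'x.
set r := enorm x in Rx x'x *.
have r0 : 0 < r := lt_le_trans R10 Rx.
have p0 : 0 < p by lra.
set D := `|_|.
(* This threshold makes both terms of [le_add_powR], integrated over the shell,
   of order r ^ (n - nu). *)
pose d := r `^ (- nu - 1).
have d0 : 0 < d by exact: powR_gt0.
pose k := d `^ (1 - p) / (m * r `^ a).
have k0 : 0 < k by rewrite divr_gt0 ?mulr_gt0 ?powR_gt0.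
(* [A] is positive only on positive radii; the maximum makes the density nonnegative at the origin
   too, and changes it only on a null set. *)
pose G (z : 'rV[R]_N) := Num.max 0 (A (enorm z) * enorm (grad u z) `^ p).
have G0 z : (0 <= (G z)%:E)%E by rewrite lee_fin le_max lexx.
have : ((D * (r / n.+1%:R) ^+ n)%:E <= (k * M + d * (4 * r) ^+ N)%:E)%E.
  apply: (le_trans (dyadic_increment_le _ _ _ _ su ru r0 erefl x'x)).
  rewrite -integral_lebesgue_rV; last 2 first.
  - exact: measurable_partial_shell.
  - by move=> z; rewrite lee_fin mulr_ge0.
  pose H (z : 'rV[R]_N) : \bar R := (d * \1_(box N (2 * r)) z)%:E.
  have mB : measurable (box N (2 * r) : set (lebesgue_rV_type R N)).
    by apply: measurable_lebesgue_rV; exact: measurable_box.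
  have mI : measurable_fun (setT : set (lebesgue_rV_type R N))
     (fun z => (\1_(box N (2 * r)) z)%:E : \bar R).
    by apply/measurable_EFinP; exact: measurable_indic.
  have mH : measurable_fun (setT : set (lebesgue_rV_type R N)) H.
    rewrite /H; under eq_fun do rewrite EFinM.
    exact: measurable_funeM.
  apply: (@le_trans _ _ (\int[mu]_z (k%:E * (G z)%:E + H z))%E).
    apply: ae_le_lower_integral; apply: aeW => z.
    rewrite indicE; case: (boolP (z \in dyadic_shell r)) => [|_]; last first.
      rewrite mulr0 -EFinM -EFinD lee_fin.
      by rewrite addr_ge0// mulr_ge0// ?(ltW k0) ?(ltW d0)// -lee_fin.
    rewrite inE mulr1 => Qz; rewrite /H indicE mem_set; last by case: Qz.
    rewrite mulr1 -EFinM -EFinD lee_fin addrC.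
    apply: (le_trans (le_add_powR _ _ _ _ p1 d0 (partial_le_enorm_grad u ord0 z))).
    rewrite lerD2l /k -mulrA ler_wpM2l ?powR_ge0//.
    rewrite ler_pdivlMl ?mulr_gt0 ?powR_gt0// /G le_max; apply/orP; right.
    by apply: ler_wpM2r; [exact: powR_ge0|exact: mA].
  apply: (le_trans (lower_integralD_le _ _ _ _ _ _ _ _ _)) => //.
  - by move=> z; rewrite mule_ge0// lee_fin ltW.
  - by move=> z; rewrite lee_fin mulr_ge0// ltW.
  rewrite EFinD; apply: leeD.
    apply: (@le_trans _ _ (k%:E * \int[mu]_z (G z)%:E)%E).
      exact: (lower_integralZl_le _ _ _ (@lebesgue_rV R N) (fun z => (G z)%:E) k G0 k0).
    rewrite (EFinM k M); apply: lee_wpmul2l; first by rewrite lee_fin ltW.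
    by apply: le_trans uM; exact: energy_pos_le.
  rewrite /H; under eq_integral do rewrite EFinM.
  rewrite ge0_integralZl_EFin//; last exact: ltW.
  rewrite integral_indic// setIT [X in (_ * X)%E](lebesgue_rVE _ _
    (measurable_box N (2 * r))).
  rewrite borel_rV_box; last by rewrite mulr_ge0// ltW.
  by rewrite -EFinM mulrA; have -> : 2 * 2 = 4 :> R by ring.
rewrite lee_fin.
have rn : 0 < r ^+ n by rewrite exprn_gt0.
have nn : (0 : R) < n.+1%:R ^+ n by rewrite exprn_gt0.
have -> : k * M = M / m * r `^ (- nu) * r ^+ n.
  have -> : k = r `^ (- nu) * r ^+ n / m.
    rewrite /k /d -powRrM -powR_mulrn ?(ltW r0)// -gt0_powRD//.
    have -> : (- nu - 1) * (1 - p) = (- nu + n%:R) + a.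
      by rewrite /nu -natr1; field; rewrite gt_eqF.
    rewrite [r `^ (_ + a)]gt0_powRD// invfM mulrACA mulfV ?mulr1// gt_eqF//.
    exact: powR_gt0.
  by move: (r `^ (- nu)) (r ^+ n) m^-1 => X Y W; ring.
have -> : d * (4 * r) ^+ N = 4 ^+ N * r `^ (- nu) * r ^+ n.
  rewrite /d gt0_powRD// powR_inv1 ?(ltW r0)// exprMn exprSr exprS.
  move: (r `^ (- nu)) (r ^+ n) (4 ^+ n) => X Y W.
  by field; rewrite gt_eqF.
rewrite expr_div_n mulrA ler_pdivrMr// -mulrDl mulrAC ler_pM2r// => DC.
by apply: (le_trans DC); rewrite -mulrDl mulrC mulrA.
Qed.

End radial_decay.

(** * Pointwise decay of smooth compactly supported radial functions *)

Section decay.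
Context {R : realType} {n : nat}.
Local Notation N := n.+1.
Local Notation mu := (@lebesgue_rV R N).
Implicit Types (u : 'rV[R]_N -> R) (A : R -> R).

#[local] Hint Extern 0 (Filter (nbhs (almost_everywhere _))) =>
  (apply: ae_lebesgue_rV_filter) : typeclass_instances.

Lemma smooth_compact_decay A (p a m R1 M : R) : 1 < p -> p - N%:R < a ->
  0 < m -> 0 < R1 -> 0 <= M -> (forall r, 0 < r -> 0 < A r) ->
  (forall r x, R1 <= r -> @dyadic_shell R n r x -> m * r `^ a <= A (enorm x)) ->
  exists2 C, 0 <= C & forall u, smooth u -> radial u -> compact (supp u) ->
  (energy A p (grad u) <= M%:E)%E ->
  forall x, R1 <= enorm x ->
  `|u x| <= C * enorm x `^ (- ((N%:R - p + a) / p)).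
Proof.
move=> p1 pa m0 R10 M0 A0 mA.
have [C C0 HC] := dyadic_decay A p a m R1 M p1 m0 R10 M0 A0 mA.
set nu := _ / p in HC *.
have nu0 : 0 < nu by rewrite divr_gt0//; lra.
pose q : R := 2 `^ (- nu).
have q0 : 0 < q by exact: powR_gt0.
have q1 : q < 1.
  rewrite /q powRN invf_lt1 ?powR_gt0//.
  have : 1 `^ nu < 2 `^ nu :> R by rewrite gt0_ltr_powR ?nnegrE ?ltr1n.
  by rewrite powR1.
have q10 : 0 < 1 - q by lra.
(* C s^-nu = C / (1 - q) (s^-nu - (2 s)^-nu), so the dyadic sum telescopes. *)
exists (C / (1 - q)); first by rewrite divr_ge0// ltW.
move=> u su ru cu uM x Rx.
have x0 : 0 < enorm x := lt_le_trans R10 Rx.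
(* Induction on the number of doublings; it stops once 2^k x has left the support of [u]. *)
have step k : `|u x| <= C / (1 - q) * (enorm x `^ (- nu) - (2 ^+ k * enorm x) `^ (- nu))
    + `|u (2 ^+ k *: x)|.
  elim: k => [|k IHk]; first by rewrite expr0 mul1r scale1r subrr mulr0 add0r.
  apply: (le_trans IHk).
  set s := 2 ^+ k * enorm x.
  have sE : enorm (2 ^+ k *: x) = s by rewrite enormZ normrX ger0_norm.
  have s'E : enorm (2 ^+ k.+1 *: x) = 2 * s.
    by rewrite enormZ normrX ger0_norm// exprS -mulrA.
  have Rs : R1 <= enorm (2 ^+ k *: x).
    by rewrite sE (le_trans Rx)// ler_peMl ?enorm_ge0// exprn_ege1// ler1n.
  have := HC u su ru uM (2 ^+ k *: x) (2 ^+ k.+1 *: x) Rs _.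
  rewrite sE => /(_ s'E) H.
  have -> : 2 ^+ k.+1 * enorm x = 2 * s by rewrite exprS -mulrA.
  have s0 : 0 <= s by rewrite mulr_ge0// ?enorm_ge0 ?exprn_ge0.
  rewrite powRM// -/q.
  have := ler_distD (u (2 ^+ k.+1 *: x)) 0 (u (2 ^+ k *: x)).
  rewrite !sub0r !normrN => tri.
  move: H tri; rewrite -/s; move: (s `^ (- nu)) => S H tri.
  have -> : C / (1 - q) * (enorm x `^ (- nu) - q * S) =
      C / (1 - q) * (enorm x `^ (- nu) - S) + C * S.
    by field; rewrite gt_eqF.
  by lra.
have [B [_ HB]] := compact_bounded cu.
have {}HB z : B + 1 < `|z| -> u z = 0.
  move=> Bz; apply/eqP; apply: contraTT Bz => uz; rewrite -leNgt.
  by apply: HB; [rewrite ltrDl|exact: subset_closure].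
have xn0 : 0 < `|x|.
  by rewrite normr_gt0; apply/eqP => xE; rewrite xE /enorm big1 ?sqrtr0 ?ltxx//
    in x0 => i _; rewrite mxE expr0n.
pose k := Num.bound (`|B + 1| / `|x|).
have kB : B + 1 < `|2 ^+ k *: x|.
  rewrite normrZ normrX ger0_norm//.
  rewrite -ltr_pdivrMr// (@le_lt_trans _ _ (`|B + 1| / `|x|))//.
    by rewrite ler_pM2r ?invr_gt0// ler_norm.
  apply: (@lt_le_trans _ _ k%:R); first by apply: archi_boundP; rewrite divr_ge0.
  by rewrite -natrX ler_nat ltnW// ltn_expl.
apply: (le_trans (step k)); rewrite (HB _ kB) normr0 addr0.
rewrite ler_wpM2l ?divr_ge0 ?(ltW q10)// gerBl; exact: powR_ge0.
Qed.

(** The lower limit gives A(s) >= (c / 2) s^a for s > B. On the shell s / r lies between 1 / 2 and 2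
    N, where t^a is smallest at an endpoint chosen by the sign of [a]; hence the minimum [k]. *)
Lemma lower_power_bound A (a c : R) : 0 < c ->
  (c%:E <= limf_einf (fun r => (A r / r `^ a)%:E) +oo%R)%E ->
  exists m R1, [/\ 0 < m, 0 < R1 & forall r (x : 'rV[R]_N), R1 <= r ->
    dyadic_shell r x -> m * r `^ a <= A (enorm x)].
Proof.
move=> c0 cA.
have : (limf_esup (\- (fun r => (A r / r `^ a)%:E)) +oo%R < (- (c / 2))%:E)%E.
  apply: (@le_lt_trans _ _ (- c%:E)%E); last by rewrite -EFinN lte_fin; lra.
  by rewrite leeNr.
rewrite limf_esupE => /ereal_inf_lt[_ [W [B [_ BW]] <-] supW].
have AB s : B < s -> c / 2 <= A s / s `^ a.
  move=> Bs; have Ws := BW _ Bs.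
  have : (- (A s / s `^ a)%:E <= (- (c / 2))%:E)%E.
    by apply: (le_trans _ (ltW supW)); apply: ereal_sup_ubound; exists s.
  by rewrite -EFinN lee_fin lerN2.
pose k : R := Num.min ((1 / 2) `^ a) ((2 * N%:R) `^ a).
have N0 : (0 : R) < N%:R by [].
have k0 : 0 < k by rewrite lt_min !powR_gt0.
(* The factor 2 in the radius ensures |x| >= r / 2 > B on the shell. *)
exists (c / 2 * k), (2 * (`|B| + 1)); split.
- by rewrite mulr_gt0//; lra.
- by rewrite mulr_gt0// ltr_wpDl.
- move=> r x Rr [xb xr].
  have B0 : 0 <= `|B| by [].
  have r0 : 0 < r by lra.
  have /= xr' : r / 2 <= enorm x := xr.
  have s0 : 0 < enorm x by lra.
  have sB : B < enorm x by have := ler_norm B; lra.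
  have xrN : enorm x <= 2 * N%:R * r.
    rewrite -(ler_pXn2r (n := 2)) ?nnegrE// ?(ltW s0)//; last first.
      by rewrite !mulr_ge0// ltW.
    rewrite (le_trans (enorm_box _ _ xb))// !exprMn.
    rewrite [leRHS]mulrAC [leRHS]mulrC ler_wpM2r//; first by rewrite mulr_ge0 ?sqr_ge0.
    by rewrite -natrX ler_nat -[leqLHS]muln1 expnS leq_mul.
  have := AB _ sB; rewrite ler_pdivlMr ?powR_gt0//; apply: le_trans.
  rewrite -(mulrA (c / 2)) ler_wpM2l//; first lra.
  set s := enorm x in xr' xrN s0 *.
  have -> : s = s / r * r by rewrite divfK// gt_eqF.
  have sr0 : 0 < s / r by rewrite divr_gt0.
  rewrite powRM ?(ltW sr0) ?(ltW r0)// ler_wpM2r ?powR_ge0//.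
  rewrite /k ge_min; apply/orP; have [a0|a0] := leP 0 a; [left|right].
    by rewrite ge0_ler_powR ?nnegrE ?(ltW sr0)// ler_pdivlMr//; lra.
  by apply: le0_ger_powR => //; [exact: ltW|rewrite ler_pdivrMr].
Qed.

End decay.

(** * Passage of the decay to [D_A] *)

Section X_decay.
Context {R : realType} {n : nat}.
Local Notation N := n.+1.
Local Notation mu := (@lebesgue_rV R N).
Local Notation setTL := (setT : set (lebesgue_rV_type R N)).
Implicit Types (u : 'rV[R]_N -> R) (A : R -> R).

#[local] Hint Extern 0 (Filter (nbhs (almost_everywhere _))) =>
  (apply: ae_lebesgue_rV_filter) : typeclass_instances.

(** A crude triangle inequality, from (a + b)^2 <= 2 a^2 + 2 b^2 in each coordinate; only a bounded
    energy is wanted from it. *)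
Lemma enormD_le (x y : 'rV[R]_N) : enorm (x + y) <= 2 * Num.max (enorm x) (enorm y).
Proof.
set M := Num.max _ _.
have M0 : 0 <= M by rewrite le_max enorm_ge0.
have xM : enorm x ^+ 2 <= M ^+ 2.
  by rewrite lerXn2r ?nnegrE ?enorm_ge0// le_max lexx.
have yM : enorm y ^+ 2 <= M ^+ 2.
  by rewrite lerXn2r ?nnegrE ?enorm_ge0// le_max lexx orbT.
rewrite -(ler_pXn2r (n := 2)) ?nnegrE ?enorm_ge0 ?mulr_ge0//.
apply: (@le_trans _ _ (2 * enorm x ^+ 2 + 2 * enorm y ^+ 2));
  last by rewrite exprMn; lra.
rewrite !sqr_enorm !mulr_sumr -big_split; apply: ler_sum => i _; rewrite !mxE /=.
by rewrite -subr_ge0; apply: (le_trans (sqr_ge0 (x ord0 i - y ord0 i)));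
  rewrite le_eqVlt; apply/orP; left; apply/eqP; ring.
Qed.

Lemma powR_enormD_le p (x y : 'rV[R]_N) : 0 < p ->
  enorm (x + y) `^ p <= 2 `^ p * (enorm x `^ p + enorm y `^ p).
Proof.
move=> p0; apply: (@le_trans _ _ ((2 * Num.max (enorm x) (enorm y)) `^ p)).
  rewrite ge0_ler_powR ?nnegrE ?enorm_ge0 ?(ltW p0)//; last exact: enormD_le.
  by rewrite mulr_ge0// le_max enorm_ge0.
rewrite powRM ?le_max ?enorm_ge0// ler_wpM2l ?powR_ge0//.
by rewrite /Num.max; case: ifP => _; rewrite ?lerDl ?lerDr powR_ge0.
Qed.

Lemma measurable_enorm_comp (G : 'rV[R]_N -> 'rV[R]_N) :
  (forall i, measurable_fun setTL (fun x => G x ord0 i)) ->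
  measurable_fun setTL (fun x => enorm (G x)).
Proof.
move=> mG; apply: (measurableT_comp (f := @Num.sqrt R)).
  by apply: continuous_measurable_fun; exact: sqrt_continuous.
by apply: measurable_sum => i; apply: measurable_funX; exact: mG.
Qed.

Lemma energyD_le A p (G H : 'rV[R]_N -> 'rV[R]_N) : 0 < p ->
  (forall r, 0 < r -> 0 < A r) -> {within `]0, +oo[, continuous A} ->
  (forall i, measurable_fun setTL (fun x => H x ord0 i)) ->
  (energy A p (fun x => (G x + H x)%R) <= (2 `^ p)%:E * (energy A p G + energy
    A p H))%E.
Proof.
move=> p0 A0 cA mH.
(* Extending [A] by zero off the positive half-line makes it measurable and nonnegative everywhere;
   A(|x|) is unchanged for x != 0. *)
pose A' := A \_ `]0, +oo[.
have mA' : measurable_fun setT A'.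
  have mD : measurable (`]0, +oo[%classic : set R) by exact: measurable_itv.
  apply: (iffLR (measurable_restrictT A mD)).
  exact: subspace_continuous_measurable_fun.
have A'0 r : 0 <= A' r.
  by rewrite /A' /patch; case: ifPn => //; rewrite inE /= in_itv /= andbT => /A0/ltW.
have A'E (x : 'rV[R]_N) : x != 0 -> A' (enorm x) = A (enorm x).
  by move=> /enorm_gt0 x0; rewrite /A' /patch mem_set//= in_itv /= x0.
pose I (G : 'rV[R]_N -> 'rV[R]_N) x := (A' (enorm x) * enorm (G x) `^ p)%:E.
have I0 F x : (0 <= I F x)%E by rewrite lee_fin mulr_ge0// powR_ge0.
have IE F : (\int[mu]_x I F x <= energy A p F)%E.
  apply: ae_le_lower_integral; apply: filterS ae_neq0 => x x0.
  by rewrite /I A'E.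
have mI : measurable_fun setTL (I H).
  apply/measurable_EFinP; apply: measurable_funM.
    apply: (measurableT_comp mA').
    by apply: measurable_fun_lebesgue_rV; exact: measurable_enorm.
  apply: (measurableT_comp (measurable_powR p)).
  exact: measurable_enorm_comp.
pose J x := (I G x + I H x)%E.
have J0 x : (0 <= J x)%E by exact: adde_ge0.
apply: (@le_trans _ _ (\int[mu]_x ((2 `^ p)%:E * J x))%E).
  apply: ae_le_lower_integral; apply: filterS ae_neq0 => x x0.
  rewrite /J /I A'E// -EFinD -EFinM lee_fin -mulrDr mulrCA.
  rewrite ler_wpM2l//; first by rewrite ltW// A0// enorm_gt0.
  exact: powR_enormD_le.
have p2 : 0 < 2 `^ p :> R by rewrite powR_gt0.
apply: (@le_trans _ _ ((2 `^ p)%:E * \int[mu]_x J x)%E).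
  apply: (lower_integralZl_le _ _ _ (@lebesgue_rV R N) J) => //.
apply: lee_wpmul2l; first by rewrite lee_fin ltW.
apply: (@le_trans _ _ (\int[mu]_x I G x + \int[mu]_x I H x)%E).
  exact: (lower_integralD_le _ _ _ (@lebesgue_rV R N) (I G) (I H)).
exact: leeD.
Qed.

Lemma energy_lt1 A p (G : 'rV[R]_N -> 'rV[R]_N) : 0 < p ->
  (normA A p G < 1)%E -> (energy A p G < 1)%E.
Proof.
move=> p0; rewrite -/(energy A p G); apply: contraTT; rewrite -!leNgt => E1.
rewrite -(@poweR1r R p^-1); apply: gt0_ler_poweR => //.
- by rewrite invr_ge0 ltW.
- by rewrite in_itv /= lee01 leey.
- by rewrite in_itv /= leey andbT (le_trans _ E1)// lee01.
Qed.

(** The approximating gradients are eventually within distance 1 of the weak gradient, so their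
    energies are at most 2^p (1 + 1). The smooth bound then holds with one constant for all large
    [k] and survives the pointwise limit. *)
Lemma D_A_decay A (p a m R1 : R) : 1 < p -> p - N%:R < a ->
  0 < m -> 0 < R1 -> (forall r, 0 < r -> 0 < A r) ->
  {within `]0, +oo[, continuous A} ->
  (forall r x, R1 <= r -> @dyadic_shell R n r x -> m * r `^ a <= A (enorm x)) ->
  exists2 C, 0 <= C & forall u, D_A A p u -> (energy A p (weak_grad u) <= 1)%E ->
  {ae mu, forall x, R1 <= enorm x ->
    `|u x| <= C * enorm x `^ (- ((N%:R - p + a) / p))}.
Proof.
move=> p1 pa m0 R10 A0 cA mA.
have p0 : 0 < p by lra.
have M0 : 0 <= 2 `^ p * (1 + 1) :> R by rewrite mulr_ge0// powR_ge0.
have [C C0 HC] := smooth_compact_decay A p a m R1 _ p1 pa m0 R10 M0 A0 mA.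
exists C => // u [ru wu [u_ [Su cvgG cvgu]]] u1.
have [_ mW _] : is_weak_grad u (weak_grad u) by apply: xgetPex.
have near_energy : \forall k \near \oo, (energy A p (grad (u_ k)) <= (2 `^ p *
  (1 + 1))%:E)%E.
  have : \forall k \near \oo, (normA A p (fun x => (grad (u_ k) x - weak_grad u
    x)%R) < 1)%E.
    apply: (cvgG [set y : \bar R | (y < 1)%E]).
    by apply: (@open_ereal_lt' R 0%E 1%E); rewrite lte01.
  apply: filterS => k /(energy_lt1 _ _ _ p0) Gk.
  have -> : grad (u_ k) = fun x => ((grad (u_ k) x - weak_grad u x) + weak_grad u x)%R.
    by apply/funext => x; rewrite subrK.
  apply: (le_trans (energyD_le _ _ _ _ p0 A0 cA _)); first by move=> i; have [] := mW i.
  rewrite EFinM; apply: lee_wpmul2l; first by rewrite lee_fin powR_ge0.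
  exact: (leeD (ltW Gk) u1).
apply: filterS cvgu => x ux Rx.
apply: (cvgr_to_le (cvg_norm ux)).
apply: filterS near_energy => k Ek.
by have [? ? ? _] := Su k; exact: HC.
Qed.

End X_decay.

(** * Pointwise bound of the integrand *)

Section real_lemmas.
Context {R : realType}.

(** Bound both bases by X + Y; the exponents add up to 1. *)
Lemma powRM_le_add (b X Y : R) : 0 <= b <= 1 -> 0 <= X -> 0 < Y ->
  X `^ b * Y `^ (1 - b) <= X + Y.
Proof.
move=> /andP[b0 b1] X0 Y0; have XY0 : 0 < X + Y by lra.
have XYE : (X + Y) `^ b * (X + Y) `^ (1 - b) = X + Y.
  by rewrite -gt0_powRD// subrKC powRr1// ltW.
rewrite -[leRHS]XYE ler_pM ?powR_ge0//.
  by rewrite ge0_ler_powR ?nnegrE ?(ltW XY0)//; lra.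
by rewrite ge0_ler_powR ?nnegrE ?(ltW XY0) ?(ltW Y0)//; lra.
Qed.

(** Write w^q = (w^p)^be w^(q - p be): the first factor joins V^be to form X^be, and the decay is
    spent on the second, whose exponent is positive. *)
Lemma integrand_le (N p q nu al be C L V K s w r d : R) :
  1 < p -> 0 < C -> 0 <= be <= 1 -> 0 <= L -> 0 <= V -> 1 <= r -> r <= s -> 0 <= w ->
  d = nu * (q - p * be) - al - N * (1 - be) -> 0 < d -> 0 < q -> p * be < q ->
  w <= C * s `^ (- nu) -> K <= L * (s `^ al * V `^ be) ->
  K * w `^ q <= L * C `^ (q - p * be) * r `^ (- (d / 2)) *
    (V * w `^ p + s `^ (- (N + d / 2))).
Proof.
move=> p1 C0 be01 L0 V0 r1 rs w0 dE d0 q0 pbq wC KV.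
have s1 : 1 <= s := le_trans r1 rs.
have s0 : 0 < s by lra.
have [b0 b1] := andP be01.
have [->|wn0] := eqVneq w 0.
  by rewrite powR0 ?(gt_eqF q0)// mulr0 !mulr_ge0 ?addr_ge0 ?mulr_ge0 ?powR_ge0.
have {wn0}wp : 0 < w by rewrite lt_neqAle eq_sym wn0.
apply: (@le_trans _ _ (L * (s `^ al * V `^ be) * w `^ q)).
  by rewrite ler_wpM2r ?powR_ge0.
have -> : w `^ q = (w `^ p) `^ be * w `^ (q - p * be).
  by rewrite -powRrM -gt0_powRD// subrKC.
set X := V * w `^ p; set Y := s `^ (- (N + d / 2)).
have X0 : 0 <= X by rewrite mulr_ge0// powR_ge0.
have Y0 : 0 < Y by rewrite powR_gt0.
have -> : L * (s `^ al * V `^ be) * ((w `^ p) `^ be * w `^ (q - p * be)) =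
    L * (s `^ al * X `^ be * w `^ (q - p * be)).
  by rewrite /X powRM ?powR_ge0//; ring.
rewrite -!(mulrA L) ler_wpM2l//.
apply: (@le_trans _ _ (s `^ al * X `^ be * (C `^ (q - p * be) * s `^ (- nu * (q
  - p * be))))).
  rewrite ler_wpM2l ?mulr_ge0 ?powR_ge0// powRrM -powRM ?powR_ge0 ?(ltW C0)//.
  rewrite ge0_ler_powR ?nnegrE//; first by lra.
  by rewrite mulr_ge0 ?powR_ge0 ?(ltW C0).
(* By the value of [d], the total exponent of s is - d - N (1 - be). Taking out Y^(1 - be) leaves -
   d / 2 - d be / 2, enough to extract r^(- d / 2). *)
have -> : s `^ al * X `^ be * (C `^ (q - p * be) * s `^ (- nu * (q - p * be))) =
   C `^ (q - p * be) * (s `^ (- (d / 2) - d * be / 2) * (X `^ be * Y `^ (1 - be))).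
  have -> : Y `^ (1 - be) = s `^ (- (N + d / 2) * (1 - be)) by rewrite powRrM.
  have E : s `^ al * s `^ (- nu * (q - p * be)) =
      s `^ (- (d / 2) - d * be / 2) * s `^ (- (N + d / 2) * (1 - be)).
    by rewrite -!gt0_powRD//; congr powR; rewrite dE; field.
   transitivity (X `^ be * C `^ (q - p * be) * (s `^ al * s `^ (- nu * (q - p * be)))).
    by ring.
  by rewrite E; ring.
rewrite -!mulrA ler_wpM2l ?powR_ge0// ler_pM ?mulr_ge0 ?powR_ge0//.
  apply: (@le_trans _ _ (s `^ (- (d / 2)))).
    have dbe0 : 0 <= d * be by rewrite mulr_ge0// ltW.
    by rewrite ler_powR//; lra.
  by apply: le0_ger_powR => //; lra.
by apply: powRM_le_add.
Qed.

Lemma geometric_nneseries_lty (C q : R) : 0 <= C -> 0 <= q < 1 ->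
  (\sum_(0 <= k <oo) (C * q ^+ k)%:E < +oo)%E.
Proof.
move=> C0 /andP[q0 q1].
have q10 : 0 < 1 - q by lra.
apply: (@le_lt_trans _ _ (C / (1 - q))%:E); last by rewrite ltry.
apply: lime_le.
  by apply: is_cvg_nneseries => k _ _; rewrite lee_fin mulr_ge0// exprn_ge0.
apply: nearW => k; rewrite sumEFin lee_fin.
have -> : \sum_(0 <= i < k) C * q ^+ i = C / (1 - q) * (1 - q ^+ k).
  elim: k => [|k IHk]; first by rewrite big_nil expr0 subrr mulr0.
  rewrite big_nat_recr//= IHk exprS; field; exact: lt0r_neq0.
by rewrite ler_piMr ?divr_ge0 ?(ltW q10)// gerBl exprn_ge0.
Qed.

End real_lemmas.

(** * An integrable majorant at infinity *)

Section tail.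
Context {R : realType} {n : nat}.
Local Notation N := n.+1.
Local Notation mu := (@lebesgue_rV R N).
Local Notation setTL := (setT : set (lebesgue_rV_type R N)).

(** Dyadic cubes replace polar coordinates: [W] is the sum over k of 2^(-k (N + e)) times the
    indicator of the cube of half-side 2^(k+1). Its terms have integral 4^N 2^(-e k), a convergent
    geometric series. *)
Lemma tail_majorant (e : R) : 0 < e ->
  exists W : 'rV[R]_N -> \bar R, [/\ measurable_fun setTL W,
    forall x, (0 <= W x)%E, (\int[mu]_x W x < +oo)%E &
    forall x, 1 <= enorm x -> ((enorm x `^ (- (N%:R + e)))%:E <= W x)%E].
Proof.
move=> e0.
pose c k : R := (2 ^+ k) `^ (- (N%:R + e)).
have c0 k : 0 <= c k by exact: powR_ge0.
pose f k (x : 'rV[R]_N) : \bar R := ((c k)%:E * (\1_(box N (2 ^+ k.+1)) x)%:E)%E.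
have f0 k x : (0 <= f k x)%E by rewrite mule_ge0// lee_fin.
have mB r : measurable (box N r : set (lebesgue_rV_type R N)).
  by apply: measurable_lebesgue_rV; exact: measurable_box.
have mI r : measurable_fun setTL (fun x => (\1_(box N r) x)%:E : \bar R).
  by apply/measurable_EFinP; exact: measurable_indic.
have mf k : measurable_fun setTL (f k) by exact: measurable_funeM.
have int_f k : (\int[mu]_x f k x = (4 ^+ N * (2 `^ (- e)) ^+ k)%:E)%E.
  rewrite ge0_integralZl_EFin// integral_indic// setIT.
  rewrite [X in (_ * X)%E](lebesgue_rVE _ _ (measurable_box N (2 ^+ k.+1))).
  rewrite borel_rV_box ?exprn_ge0// -EFinM; congr EFin.
  rewrite /c opprD gt0_powRD ?exprn_gt0// powR_invn ?exprn_ge0//.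
  have -> : 2 * 2 ^+ k.+1 = 4 * 2 ^+ k :> R by rewrite exprS; ring.
  have -> : (2 ^+ k) `^ (- e) = (2 `^ (- e)) ^+ k :> R.
    by rewrite -[2 ^+ k]powR_mulrn// powRAC powR_mulrn// powR_ge0.
  rewrite exprMn; move: (4 ^+ N) ((2 `^ (- e)) ^+ k) => X Y.
  have h : (2 ^+ k) ^+ N != 0 :> R by rewrite !expf_neq0.
  by move: ((2 ^+ k) ^+ N) h => Z Z0; field.
exists (fun x => \sum_(0 <= k <oo) f k x)%E; split.
- by apply: ge0_emeasurable_sum.
- by move=> x; apply: nneseries_ge0.
- rewrite integral_nneseries//.
  rewrite (eq_eseriesr (fun k _ => int_f k)); apply: geometric_nneseries_lty => //.
  rewrite powR_ge0/= powRN invf_lt1 ?powR_gt0//.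
  have : 1 `^ e < 2 `^ e :> R by rewrite gt0_ltr_powR ?nnegrE ?ltr1n.
  by rewrite powR1.
- move=> x x1; set s := enorm x in x1 *.
  (* This k satisfies 2^k <= |x| <= 2^(k+1), so the term of index k alone dominates at x. *)
  pose k := trunc_log 2 (Num.truncn s).
  have t1 : (0 < Num.truncn s)%N by rewrite truncn_gt0.
  have /andP[kl ku] := trunc_log_bounds (isT : 1 < 2)%N t1.
  have ks : 2 ^+ k <= s.
    rewrite (@le_trans _ _ (Num.truncn s)%:R)//; first by rewrite -natrX ler_nat.
    by rewrite truncn_le//; lra.
  have sk : s <= 2 ^+ k.+1.
    rewrite (@le_trans _ _ (Num.truncn s).+1%:R)//; first exact/ltW/truncnS_gt.
    by rewrite -natrX ler_nat.
  apply: (@le_trans _ _ (f k x)).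
    rewrite /f indicE mem_set/= ?mule1; last first.
      by move=> i; exact: le_trans (coord_le_enorm _ _) sk.
    rewrite lee_fin; apply: le0_ger_powR; rewrite ?exprn_gt0//.
    by rewrite oppr_le0 addr_ge0// ltW.
  apply: (@le_trans _ _ (\sum_(0 <= i < k.+1) f i x)%E).
    by rewrite big_nat_recr//= leeDr// sume_ge0.
  exact: nneseries_lim_ge.
Qed.

End tail.

(** * Pointwise form of the essential bound, and consequences of unit norm *)

Lemma ess_sup_gt_bound (R : realType) (K V : R -> R) (al be R2 : R) : 0 < R2 ->
  (forall r, 0 < r -> 0 <= V r) -> 0 <= be ->
  (ess_sup_gt R2 (quotientKV K V al be) < +oo)%E ->
  exists L (Z : set R), [/\ 0 <= L, measurable Z, lebesgue_measure Z = 0%E &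
    forall r, R2 < r -> ~ Z r -> K r <= L * (r `^ al * V r `^ be)].
Proof.
move=> R20 V0 be0 /ereal_inf_lt[y /= [Z [mZ muZ fZ]] yoo].
have [L L0 yL] : exists2 L : R, 0 <= L & (y <= L%:E)%E.
  case: y yoo fZ => [y _ _|//|_ _]; last by exists 0; rewrite ?leNye.
  by exists (Num.max 0 y); rewrite ?lee_fin le_max lexx ?orbT.
(* The restricted measure says nothing of [Z] below [R2], so only its trace beyond [R2] is known to
   be null. *)
exists L, (Z `&` `]R2, +oo[%classic); split => //.
  by apply: measurableI => //; exact: measurable_itv.
move=> r Rr nZ.
have r0 : 0 < r by lra.
have : (quotientKV K V al be r <= L%:E)%E.
  apply: le_trans yL; apply: contrapT => nle; apply: nZ; split; first exact: fZ.
  by rewrite /= in_itv /= Rr.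
rewrite /quotientKV; case: ifPn => [_|]; first by rewrite leye_eq.
rewrite negb_and => bV.
rewrite lee_fin ler_pdivrMr// mulr_gt0 ?(powR_gt0 _ r0)//.
(* A finite quotient with V r = 0 forces be = 0, and then V r ^ be = 1 is still positive. *)
have [V00|V00] := eqVneq (V r) 0.
  move: bV; rewrite V00 eqxx orbF -leNgt => be0'.
  have -> : be = 0 by lra.
  by rewrite powRr0.
by rewrite powR_gt0// lt_neqAle eq_sym V00 V0.
Qed.

Lemma poweR_add_eq1 (R : realType) (p : R) (x y : \bar R) : 0 < p ->
  (0 <= x)%E -> (0 <= y)%E -> (((x `^ p^-1) `^ p + y) `^ p^-1 = 1)%E ->
  (x <= 1)%E /\ (y <= 1)%E.
Proof.
move=> p0 x0 y0.
have powK z : (0 <= z)%E -> ((z `^ p^-1) `^ p = z)%E.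
  by move=> z0; rewrite -poweRrM mulVf ?gt_eqF// poweRe1.
rewrite (powK x x0) => xy; have := powK _ (adde_ge0 x0 y0).
by rewrite xy poweR1r => ->; rewrite leeDl// leeDr.
Qed.

Section X_unit_sphere.
Context {R : realType} {n : nat}.
Local Notation N := n.+1.
Local Notation mu := (@lebesgue_rV R N).
Implicit Types (u : 'rV[R]_N -> R) (A V : R -> R).

#[local] Hint Extern 0 (Filter (nbhs (almost_everywhere _))) =>
  (apply: ae_lebesgue_rV_filter) : typeclass_instances.

Lemma intV_pos_le V p u : (forall r, 0 < r -> 0 <= V r) ->
  (\int[mu]_x (Num.max 0 (V (enorm x) * `|u x| `^ p))%:E <= intV V p u)%E.
Proof.
move=> V0; apply: ae_le_lower_integral; apply: filterS ae_neq0 => x x0.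
rewrite lee_fin ge_max lexx andbT mulr_ge0 ?powR_ge0// V0//.
exact: enorm_gt0.
Qed.

Lemma normX_eq1_le A V p u : 0 < p -> (forall r, 0 < r -> 0 < A r) ->
  (forall r, 0 < r -> 0 <= V r) -> normX A V p u = 1%E ->
  (energy A p (weak_grad u) <= 1)%E /\ (intV V p u <= 1)%E.
Proof.
move=> p0 A0 V0 u1.
have E0 : (0 <= energy A p (weak_grad u))%E.
  apply: le_trans (energy_pos_le A p (weak_grad u) A0).
  by apply: integral_ge0 => x _; rewrite lee_fin le_max lexx.
have I0 : (0 <= intV V p u)%E.
  apply: le_trans (intV_pos_le V p u V0).
  by apply: integral_ge0 => x _; rewrite lee_fin le_max lexx.
exact: (poweR_add_eq1 _ p _ _ p0 E0 I0 u1).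
Qed.

End X_unit_sphere.

(** * Uniform tail estimate on the unit sphere of X, and the limit *)

Lemma tail_integral_cvg0 (R : realType) (n : nat) (p : R) (A V K : R -> R)
    (a0 ainf c0 cinf R2 al be q : R) :
  1 < p -> hypA n.+1 p A a0 ainf c0 cinf -> (forall r, 0 < r -> 0 <= V r) ->
  0 < R2 -> 0 <= be <= 1 ->
  (ess_sup_gt R2 (quotientKV K V al be) < +oo)%E ->
  0 < q -> p * be < q -> q_star n.+1 p ainf al be < q ->
  @S_infty R n.+1 A V K p q r @[r --> +oo%R] --> 0%E.
Proof.
move=> p1 [[A0 cA] [_ /andP[pa _]] [_ cinf0] _ [cinfA _]] V0 R20 be01 KV q0 pbq qstar.
set N := n.+1 in pa qstar *.
have p0 : 0 < p by lra.
have [m [R1 [m0 R10 mA]]] := lower_power_bound (n := n) A ainf cinf cinf0 cinfA.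
have [C C0 HC] := D_A_decay A p ainf m R1 p1 pa m0 R10 A0 cA mA.
set nu := _ / p in HC.
have be0 : 0 <= be by case/andP: be01.
have [L [Z [L0 mZ Z0 HZ]]] := ess_sup_gt_bound _ K V al be R2 R20 V0 be0 KV.
pose d := nu * (q - p * be) - al - N%:R * (1 - be).
(* This is [q_star < q] with the positive denominator N - p + ainf = nu p cleared. *)
have d0 : 0 < d.
  move: qstar; rewrite /q_star mulrA ltr_pdivrMr; last lra.
  have nuE : N%:R - p + ainf = nu * p by rewrite /nu divfK// gt_eqF.
  rewrite /d nuE => h.
  have : p * (al - p * be + N%:R + ainf * be) < (q * nu) * p by rewrite -mulrA.
  rewrite mulrC ltr_pM2r// => h'.
  have : be * (N%:R - p + ainf) = be * (nu * p) by rewrite nuE.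
  by move: h'; lra.
have d20 : 0 < d / 2 by lra.
have [W [mW W0 Woo Wge]] := tail_majorant (n := n) (d / 2) d20.
have [w w0 Ww] : exists2 w : R, 0 <= w & (\int[lebesgue_rV N]_x W x <= w%:E)%E.
  have Wi : (0 <= \int[lebesgue_rV N]_x W x)%E by exact: integral_ge0.
  move: Wi Woo; case: (\int[_]_x _)%E => // w w0 _.
  by exists w; rewrite -?lee_fin.
pose C' := C + 1.
have C'0 : 0 < C' by rewrite ltr_wpDl.
(* In the last factor, 1 bounds the integral of V |u|^p and [w] that of the tail majorant. [C] and
   [L] are increased by 1 to be strictly positive. *)
pose B := (L + 1) * C' `^ (q - p * be) * (1 + w).
have B0 : 0 < B by rewrite !mulr_gt0 ?powR_gt0//; lra.
(* Beyond [R3] all three bounds hold: the majorant needs |x| >= 1, the decay |x| >= R1, the bound on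
   [K] the strict |x| > R2. *)
pose R3 := Num.max 1 (Num.max R1 (R2 + 1)).
have bound r : R3 <= r -> (@S_infty R N A V K p q r <= (B * r `^ (- (d / 2)))%:E)%E.
  move=> Rr; have [r1 rR1 rR2] : [/\ 1 <= r, R1 <= r & R2 + 1 <= r].
    by move: Rr; rewrite /R3 !ge_max => /and3P[].
  have r0 : 0 < r by lra.
  have kr0 : 0 < (L + 1) * C' `^ (q - p * be) * r `^ (- (d / 2)).
    by rewrite !mulr_gt0 ?powR_gt0//; lra.
  rewrite /S_infty ge_max lee_fin mulr_ge0 ?powR_ge0 ?(ltW B0)//=.
  apply: ge_ereal_sup => _ [u [[Du _] u1] <-].
  have [E1 I1] := normX_eq1_le A V p u p0 A0 V0 u1.
  have decay := HC u Du E1.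
  have nZ : {ae @lebesgue_rV R N, forall x, ~ Z (enorm x)}.
    have mE : measurable (@enorm R N @^-1` Z).
      by rewrite -[X in measurable X]setTI; exact: measurable_enorm.
    exists (@enorm R N @^-1` Z); split.
    - exact: measurable_lebesgue_rV.
    - by rewrite lebesgue_rVE//; exact: null_enorm_preimage.
    - by move=> x /= /contrapT.
  pose F (x : 'rV[R]_N) : \bar R := (Num.max 0 (V (enorm x) * `|u x| `^ p))%:E.
  have F0 x : (0 <= F x)%E by rewrite lee_fin le_max lexx.
  pose J x := (F x + W x)%E.
  have J0 x : (0 <= J x)%E by exact: adde_ge0.
  set k := _ * _ in kr0.
  rewrite integral_mkcond.
  apply: (@le_trans _ _ (\int[lebesgue_rV N]_x (k%:E * J x))%E).
    apply: ae_le_lower_integral.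
    move: decay nZ; apply: (@filterS2 _ _ (ae_lebesgue_rV_filter N)) => x ux nZx.
    rewrite /patch; case: ifPn => [|_]; last by rewrite mule_ge0// lee_fin ltW.
    rewrite inE /= => rx.
    have x1 : 1 <= enorm x by lra.
    have Vx : 0 <= V (enorm x) by apply: V0; lra.
    apply: (@le_trans _ _ (k%:E * ((V (enorm x) * `|u x| `^ p)%:E + (enorm x `^
      (- (N%:R + d / 2)))%:E))%E).
      rewrite -EFinD -EFinM lee_fin.
      apply: (@integrand_le R N%:R p q nu al be C' (L + 1) _ _ (enorm x) _ r d) => //.
      - by lra.
      - rewrite (le_trans (ux _))//; first lra.
        by rewrite ler_wpM2r ?powR_ge0// lerDl.
      - have := HZ (enorm x) _ nZx; move=> /(_ ltac:(lra)) h.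
        apply: (le_trans h); rewrite ler_wpM2r//; last lra.
        by rewrite mulr_ge0 ?powR_ge0.
    apply: lee_wpmul2l; first by rewrite lee_fin ltW.
    apply: leeD; last exact: Wge.
    by rewrite lee_fin le_max lexx orbT.
  apply: (@le_trans _ _ (k%:E * \int[lebesgue_rV N]_x J x)%E).
    exact: (lower_integralZl_le _ _ _ (@lebesgue_rV R N) J).
  apply: (@le_trans _ _ (k%:E * (1 + w)%:E)%E).
    apply: lee_wpmul2l; first by rewrite lee_fin ltW.
    apply: (@le_trans _ _ (\int[lebesgue_rV N]_x F x + \int[lebesgue_rV N]_x W x)%E).
      exact: (lower_integralD_le _ _ _ (@lebesgue_rV R N) F W).
    rewrite EFinD; apply: leeD; last exact: Ww.
    by apply: (le_trans _ I1); exact: intV_pos_le.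
  by rewrite -EFinM lee_fin /B /k [leRHS]mulrAC.
have limB : (B * r `^ (- (d / 2)))%:E @[r --> +oo%R] --> 0%E.
  apply: cvg_EFin; first exact: nearW.
  apply/cvgrPdist_le => e e0.
  (* This radius solves B r^(- d / 2) = e. *)
  exists ((e / B) `^ (- (2 / d))); split; first exact: num_real.
  move=> r er; rewrite /= sub0r normrN ger0_norm;
    last by rewrite mulr_ge0 ?powR_ge0 ?(ltW B0).
  have eB : 0 < e / B by rewrite divr_gt0.
  rewrite mulrC -ler_pdivlMr//.
  apply: (@le_trans _ _ (((e / B) `^ (- (2 / d))) `^ (- (d / 2)))).
    by apply: le0_ger_powR; [lra|exact: powR_gt0|exact: ltW].
  rewrite -powRrM (_ : - (2 / d) * - (d / 2) = 1); last by field; exact: lt0r_neq0.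
  by rewrite powRr1// ltW.
apply: (squeeze_cvge _ (cvg_cst _) limB).
near=> r; rewrite bound; last first.
  by near: r; apply: nbhs_pinfty_ge; exact: num_real.
by rewrite andbT /S_infty le_max lexx.
Unshelve. all: by end_near. Qed.

Theorem theorem3p3 (R : realType) (N : nat) (p : R) (A V K : R -> R)
    (a0 ainf c0 cinf : R) (R2 alphainf betainf : R) :
  (3 <= N)%N -> 1 < p < N%:R ->
  hypA N p A a0 ainf c0 cinf -> hypV V -> hypK K ->
  0 < R2 ->
  {ae @lebesgue_measure R, forall r : R, R2 < r -> ((V r)%:E < +oo)%E} ->
  0 <= betainf <= 1 ->
  (ess_sup_gt R2 (quotientKV K V alphainf betainf) < +oo)%E ->
  forall q2 : R,
    Num.max 1 (Num.max (p * betainf) (q_star N p ainf alphainf betainf)) < q2 ->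
    @S_infty R N A V K p q2 r @[r --> +oo%R] --> 0%E.
Proof.
move=> N3 /andP[p1 _] hA [V0 _ _] _ R20 _ be01 KV q2.
rewrite !gt_max => /and3P[q1 pbq qstar].
(* The dimension is written n + 1 to single out the first axis. *)
case: N N3 hA qstar => // n _ hA qstar.
have q0 : 0 < q2 by exact: lt_trans q1.
exact: (@tail_integral_cvg0 R n p A V K a0 ainf c0 cinf R2 alphainf betainf q2
  p1 hA V0 R20 be01 KV q0 pbq qstar).
Qed.
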